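(* Let $\varphi\in\mathcal{M}$. Suppose that the functions $P(z)=\varphi'(z)/\varphi(z)$ and $Q(z)=\varphi(z)-1$ have non-negative Maclaurin coefficients. Then for every $f\in\mathscr{S}^*(\varphi)$, $$\|P_f\|\le\sup_{0<s<1}\frac{1-s^2}{s}\left(\frac{s\varphi'(s)}{\varphi(s)}+\varphi(s)-1\right).$$
   Context: $\mathbb{D}=\{z\in\mathbb{C}:|z|<1\}$. $\mathscr{A}$ is the class of analytic functions $f$ on $\mathbb{D}$ with $f(0)=0$, $f'(0)=1$. For analytic $g,h$ on $\mathbb{D}$, $g\prec h$ (subordination) means $g=h\circ\omega$ for some analytic $\omega:\mathbb{D}\to\mathbb{D}$ with $\omega(0)=0$. $\mathcal{M}$ is the class of analytic univalent functions $\varphi$ in $\mathbb{D}$ with positive real part, $\varphi(0)=1$, $\varphi'(0)>0$, whose image $\varphi(\mathbb{D})$ is symmetric with respect to the real axis and starlike with respect to $1$. For $\varphi\in\mathcal{M}$, the Ma-Minda class is $\mathscr{S}^*(\varphi)=\{f\in\mathscr{A}: zf'(z)/f(z)\prec\varphi(z)\}$. For $f\in\mathscr{A}$ with $f'\neq0$ in $\mathbb{D}$, $P_f(z)=f''(z)/f'(z)$ and $\|P_f\|=\sup_{z\in\mathbb{D}}(1-|z|^2)|P_f(z)|$. *)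

(* Defs.v *)
(* Complex analysis on Coquelicot's C.  A function on the unit disk is a total
   function C -> C of which only the values on the disk are ever used. *)
From Stdlib Require Export Reals Factorial.
From Coquelicot Require Export Coquelicot.
Open Scope R_scope.

Definition unit_disk (z : C) : Prop := Cmod z < 1.

Definition analytic_at (f : C -> C) (z0 : C) : Prop :=
  exists (a : nat -> C) (r : posreal), forall z : C,
    Cmod (z - z0)%C < r ->
    @is_pseries C_AbsRing C_NormedModule a (z - z0)%C (f z).

Definition analytic_on_disk (f : C -> C) : Prop :=
  forall z : C, unit_disk z -> analytic_at f z.

Definition univalent_on_disk (f : C -> C) : Prop :=
  forall z w : C, unit_disk z -> unit_disk w -> f z = f w -> z = w.

Definition disk_image (f : C -> C) (w : C) : Prop :=
  exists z : C, unit_disk z /\ w = f z.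

Definition symmetric_real_axis (E : C -> Prop) : Prop :=
  forall w : C, E w -> E (Cconj w).

Definition starlike_wrt (w0 : C) (E : C -> Prop) : Prop :=
  forall (w : C) (t : R), E w -> 0 <= t <= 1 ->
    E (w0 + RtoC t * (w - w0))%C.

Definition class_A (f : C -> C) : Prop :=
  analytic_on_disk f /\ f (RtoC 0) = RtoC 0 /\ C_derive f (RtoC 0) = RtoC 1.

Definition subordinate (g h : C -> C) : Prop :=
  exists omega : C -> C,
    analytic_on_disk omega /\
    (forall z, unit_disk z -> unit_disk (omega z)) /\
    omega (RtoC 0) = RtoC 0 /\
    (forall z, unit_disk z -> g z = h (omega z)).

Definition class_M (phi : C -> C) : Prop :=
  analytic_on_disk phi /\
  univalent_on_disk phi /\
  (forall z, unit_disk z -> 0 < Re (phi z)) /\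
  phi (RtoC 0) = RtoC 1 /\
  (Im (C_derive phi (RtoC 0)) = 0 /\ 0 < Re (C_derive phi (RtoC 0))) /\
  symmetric_real_axis (disk_image phi) /\
  starlike_wrt (RtoC 1) (disk_image phi).

(* z f'(z) / f(z) has a removable singularity at 0, with value 1 since
   f(0) = 0 and f'(0) = 1. *)
Definition starlike_quotient (f : C -> C) (z : C) : C :=
  if Ceq_dec z (RtoC 0) then RtoC 1 else (z * C_derive f z / f z)%C.

(* The condition f z <> 0 off the origin is what makes z f'(z) / f(z) a
   function on the whole disk; division by 0 in C is total. *)
Definition ma_minda (phi f : C -> C) : Prop :=
  class_A f /\
  (forall z, unit_disk z -> z <> RtoC 0 -> f z <> RtoC 0) /\
  subordinate (starlike_quotient f) phi.

Definition maclaurin_coeff (f : C -> C) (n : nat) : C :=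
  (Nat.iter n C_derive f (RtoC 0) / RtoC (INR (fact n)))%C.

Definition nonneg_maclaurin (f : C -> C) : Prop :=
  forall n : nat,
    Im (maclaurin_coeff f n) = 0 /\ 0 <= Re (maclaurin_coeff f n).

Definition pre_schwarzian (f : C -> C) (z : C) : C :=
  (C_derive (C_derive f) z / C_derive f z)%C.

Definition pre_schwarzian_norm (f : C -> C) : Rbar :=
  Lub_Rbar (fun x : R => exists z : C, unit_disk z /\
    x = (1 - Cmod z ^ 2) * Cmod (pre_schwarzian f z)).

(* When phi'/phi and phi - 1 have real Maclaurin coefficients, the complex
   number under Re is real for 0 < s < 1. *)
Definition bound_at (phi : C -> C) (s : R) : R :=
  (1 - s ^ 2) / s *
  Re (RtoC s * C_derive phi (RtoC s) / phi (RtoC s)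
      + phi (RtoC s) - RtoC 1)%C.

(* Main.v *)
From Stdlib Require Import Lra Lia Psatz.
Require Import Defs.

(** Write w = omega z, P = phi'/phi, Q = phi - 1.  Differentiating
    z f'(z) = f(z) phi(w) and dividing by z f'(z) gives, for z <> 0,

      f''(z) / f'(z) = P(w) omega'(z) + Q(w) / z       ([pre_schwarzian_eq]).

    Let s = |w|.  Non-negative coefficients give |P(w)| <= P(s) and |Q(w)| <= Q(s)
    ([nonneg_maclaurin_majorant]).  The Schwarz-Pick lemma replaces (1 - |z|^2) |omega'(z)|
    by 1 - s^2 ([schwarz_pick]); Schwarz's lemma s <= |z| ([schwarz]) and the monotonicity of
    (1 - t^2) / t replace (1 - |z|^2) / |z| by (1 - s^2) / s.  The sum of the two terms is the
    quantity whose supremum is on the right-hand side, evaluated at s.  The points with w = 0,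
    and then z = 0 itself, follow by letting a real variable tend to 0 ([Re_le_at_0]).

    Analyticity means local expandability in power series, so three facts of function theory
    are derived from that.

    - Derivatives and quotients of analytic functions are analytic: a power series can be
      differentiated termwise ([has_ps_derive]), and the coefficients of a quotient, defined
      by the usual recursion, grow at most geometrically ([quot_coeff_bound]).

    - The majorant principle does not go through convergence of the Maclaurin series on the
      whole disk.  Along a ray of direction e one propagates the system of inequalities
      |g^(n)(t e)| <= g^(n)(t), all n at once: the local Taylor expansions at t e and at t carry
      it a little further, and continuity carries it to limits ([deriv_n_dominated]).

    - Schwarz-Pick reduces, by Moebius maps, to |psi'(0)| <= 1 for self-maps psi of the disk.
      For that, the integral over theta of Re (e^(-i theta) psi(r e^(i theta))) is shown to be
      a linear function of r, of slope 2 pi Re psi'(0), while it is at most 2 pi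
      ([circle_int_linear], [Re_deriv_0_le_1]).  Schwarz's lemma is then obtained by
      integrating the infinitesimal inequality of Schwarz-Pick along a radius. *)

(** * Complex derivatives and series *)

(** The complex numbers carry two uniform structures, the one of the modulus and the product
    one.  The codomain is taken here with the modulus, since the general rules for derivatives
    of products and composites are stated for that structure; [is_cderive_C_derive] goes back
    to [C_derive]. *)
Notation is_cderive := (@is_derive C_AbsRing (AbsRing_NormedModule C_AbsRing)).

Lemma is_cderive_eps (f : C -> C) (z l : C) :
  is_cderive f z l <->
  forall eps, 0 < eps -> exists d, 0 < d /\ forall w, Cmod (w - z)%C < d ->
    Cmod (f w - f z - l * (w - z))%C <= eps * Cmod (w - z)%C.
Proof.
  assert (E : forall w, (f w - f z - l * (w - z))%C = ((f w - f z) - (w - z) * l)%C)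
    by (intros w; ring).
  split.
  - intros [_ H] eps He.
    destruct (H z (fun P HP => HP) (mkposreal eps He)) as [d Hd].
    exists d. split. apply cond_pos. intros w Hw. rewrite E. exact (Hd w Hw).
  - intros H. split. apply is_linear_scal_l.
    intros x Hx.
    assert (x = z) as ->.
    { symmetry. now apply (@is_filter_lim_locally_unique _ (AbsRing_NormedModule C_AbsRing)). }
    intros [eps He]. destruct (H eps He) as [d [Hd0 Hd]].
    exists (mkposreal d Hd0). intros w Hw.
    change (Cmod ((f w - f z) - (w - z) * l)%C <= eps * Cmod (w - z)%C).
    rewrite <- E. exact (Hd w Hw).
Qed.

Lemma is_cderive_C_derive f z l : is_cderive f z l -> C_derive f z = l.
Proof.
  intros H. apply is_C_derive_unique.
  assert (E : forall w, (f w - f z - l * (w - z))%C = ((f w - f z) - (w - z) * l)%C)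
    by (intros w; ring).
  rewrite is_cderive_eps in H.
  split. apply is_linear_scal_l.
  intros x Hx.
  assert (x = z) as ->.
  { symmetry. now apply (@is_filter_lim_locally_unique _ (AbsRing_NormedModule C_AbsRing)). }
  intros [eps He]. destruct (H eps He) as [d [Hd0 Hd]].
  exists (mkposreal d Hd0). intros w Hw.
  change (Cmod ((f w - f z) - (w - z) * l)%C <= eps * Cmod (w - z)%C).
  rewrite <- E. exact (Hd w Hw).
Qed.

Lemma sum_n_C (u : nat -> C) n :
  sum_n u n = (sum_n (fun n => Re (u n)) n, sum_n (fun n => Im (u n)) n).
Proof.
  induction n as [|n IHn]. rewrite !sum_O. now destruct (u 0%nat).
  rewrite !sum_Sn, IHn. reflexivity.
Qed.

Lemma is_series_C (u : nat -> C) (l : C) :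
 @is_series C_AbsRing C_NormedModule u l <->
 is_series (fun n => Re (u n)) (Re l) /\ is_series (fun n => Im (u n)) (Im l).
Proof.
  pose proof (sum_n_C u) as Hs.
  unfold is_series.
  split.
  - intros H. split; apply filterlim_locally; intros eps;
    generalize (proj1 (@filterlim_locally _ C_UniformSpace _ _ _ _) H eps); apply filter_imp;
    intros n Hn; rewrite Hs in Hn; apply Hn.
  - intros [H1 H2].
    refine (proj2 (@filterlim_locally _ C_UniformSpace _ _ _ _) _). intros eps.
    generalize (filter_and _ _
      (proj1 (filterlim_locally _ _) H1 eps) (proj1 (filterlim_locally _ _) H2 eps)).
    apply filter_imp. intros n [A B]. rewrite Hs. split; assumption.
Qed.

Notation cseries := (@is_series C_AbsRing C_NormedModule).

Lemma cseries_norm_le (u : nat -> C) (v : nat -> R) (l : C) (m : R) :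
  cseries u l -> is_series v m -> (forall n, Cmod (u n) <= v n) -> Cmod l <= m.
Proof.
  intros Hu Hv H.
  assert (Hp : forall n, Cmod (sum_n u n) <= sum_n v n).
  { intros n; induction n as [|n IHn]. rewrite !sum_O. apply H.
    rewrite !sum_Sn. eapply Rle_trans. apply Cmod_triangle. apply Rplus_le_compat; auto. }
  apply (filterlim_le (F:=eventually) (fun n => Cmod (sum_n u n)) (sum_n v) (Cmod l) m).
  - exists 0%nat. intros; apply Hp.
  - eapply filterlim_comp. apply Hu. exact (@filterlim_norm _ C_NormedModule l).
  - exact Hv.
Qed.

Lemma ex_cseries_abs (u : nat -> C) :
  ex_series (fun n => Cmod (u n)) -> exists l : C, cseries u l.
Proof. intros H. apply (@ex_series_le _ C_CompleteNormedModule u _ (fun n => Rle_refl _) H). Qed.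

Lemma Cmod_le_Re_Im z : Cmod z <= Rabs (Re z) + Rabs (Im z).
Proof.
  destruct z as [x y]. simpl. replace (x, y) with (RtoC x + RtoC y * Ci)%C.
  eapply Rle_trans. apply Cmod_triangle. rewrite Cmod_mult, !Cmod_R, Cmod_Ci. lra.
  unfold RtoC, Ci, Cmult, Cplus; simpl. f_equal; ring.
Qed.

Lemma im_le_Cmod z : Rabs (Im z) <= Cmod z.
Proof. eapply Rle_trans; [|apply Rmax_Cmod]. apply Rmax_r. Qed.

Lemma cseries_terms_bounded (u : nat -> C) l :
  cseries u l -> exists M, forall n, Cmod (u n) <= M.
Proof.
  intros H. apply is_series_C in H. destruct H as [H1 H2].
  assert (B : forall v : nat -> R, ex_series v -> exists M, forall n, Rabs (v n) <= M).
  { intros v Hv. apply ex_series_lim_0 in Hv.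
    destruct (filterlim_bounded v (ex_intro _ 0 Hv)) as [M HM]. now exists M. }
  destruct (B _ (ex_intro _ _ H1)) as [M1 HM1]. destruct (B _ (ex_intro _ _ H2)) as [M2 HM2].
  exists (M1 + M2). intros n. eapply Rle_trans. apply Cmod_le_Re_Im.
  specialize (HM1 n); specialize (HM2 n); lra.
Qed.

(** * Termwise differentiation of power series *)

Definition ps_sum (a : nat -> C) (h l : C) : Prop := cseries (fun n => a n * h ^ n)%C l.

Lemma is_pseries_ps_sum a h l :
  @is_pseries C_AbsRing C_NormedModule a h l <-> ps_sum a h l.
Proof.
  assert (E : forall n, @pow_n C_AbsRing h n = (h ^ n)%C).
  { intros n; induction n as [|n IHn]; simpl; [|rewrite IHn]; reflexivity. }
  assert (E' : forall n, scal (pow_n h n) (a n) = (a n * h ^ n)%C).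
  { intros n. rewrite E. apply Cmult_comm. }
  split; apply is_series_ext; intros n; [|symmetry]; apply E'.
Qed.

(** Majorizing by the real series of moduli makes the theory of the real radius of convergence
    available for complex coefficients. *)
Lemma ps_sum_CV_radius a (rho : R) l :
  0 <= rho -> ps_sum a (RtoC rho) l -> Rbar_le rho (CV_radius (fun n => Cmod (a n))).
Proof.
  intros Hr H. apply cseries_terms_bounded in H. destruct H as [M HM].
  apply (proj1 (CV_radius_bounded _)). exists M. intros n. eapply Rle_trans; [|apply (HM n)].
  rewrite Cmod_mult, Cmod_pow, Cmod_R, Rabs_mult, <- RPow_abs, (Rabs_pos_eq (Cmod _)).
  apply Rle_refl. apply Cmod_ge_0.
Qed.

Lemma ex_series_Cmod_pow a (t : R) : 0 <= t -> Rbar_lt t (CV_radius (fun n => Cmod (a n))) ->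
  ex_series (fun n => Cmod (a n) * t ^ n).
Proof.
  intros Ht H. apply (ex_series_ext (fun n => Rabs (Cmod (a n) * t ^ n))).
  intros n. apply Rabs_pos_eq. apply Rmult_le_pos. apply Cmod_ge_0. now apply pow_le.
  apply CV_disk_inside. now rewrite Rabs_pos_eq.
Qed.

Lemma ex_ps_sum a h : Rbar_lt (Cmod h) (CV_radius (fun n => Cmod (a n))) -> exists l, ps_sum a h l.
Proof.
  intros H. apply ex_cseries_abs.
  eapply ex_series_ext; [|apply ex_series_Cmod_pow; [apply Cmod_ge_0|exact H]].
  intros n. simpl. now rewrite Cmod_mult, Cmod_pow.
Qed.

Definition ps_deriv (a : nat -> C) (n : nat) : C := (RtoC (INR (S n)) * a (S n))%C.

Lemma Cmod_ps_deriv a n : Cmod (ps_deriv a n) = PS_derive (fun n => Cmod (a n)) n.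
Proof.
  unfold ps_deriv, PS_derive. rewrite Cmod_mult, Cmod_R, Rabs_pos_eq. reflexivity.
  apply pos_INR.
Qed.

Lemma CV_radius_ps_deriv a : CV_radius (fun n => Cmod (ps_deriv a n)) =
  CV_radius (fun n => Cmod (a n)).
Proof.
  rewrite <- (CV_radius_derive (fun n => Cmod (a n))). apply CV_radius_ext.
  apply Cmod_ps_deriv.
Qed.

(** The error of the tangent line to z^(n+2): with a bound by the second derivative of t^(n+2),
    the errors sum up to the twice differentiated series of moduli. *)
Lemma pow_tangent_bound (t : R) (w x : C) : Cmod w <= t -> Cmod x <= t -> forall n,
  Cmod (w ^ S (S n) - x ^ S (S n) - RtoC (INR (S (S n))) * x ^ (S n) * (w - x))%C <=
  INR (S (S n)) * INR (S n) * t ^ n * Cmod (w - x)%C ^ 2.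
Proof.
  intros Hw Hx n.
  assert (Ht : 0 <= t) by (eapply Rle_trans; [apply Cmod_ge_0|exact Hw]).
  induction n as [|n IHn].
  - replace (w ^ 2 - x ^ 2 - RtoC (INR 2) * x ^ 1 * (w - x))%C with ((w - x) ^2)%C.
    2:{ simpl INR. rewrite RtoC_plus. simpl. ring. }
    rewrite Cmod_pow. simpl. pose proof (pow2_ge_0 (Cmod (w - x)%C)). simpl in H. lra.
  - replace (w ^ S (S (S n)) - x ^ S (S (S n)) - RtoC (INR (S (S (S n)))) * x ^ S (S n) *
      (w - x))%C with
     (w * (w ^ S (S n) - x ^ S (S n) - RtoC (INR (S (S n))) * x ^ (S n) * (w - x)) +
       RtoC (INR (S (S n))) * x ^ S n * (w - x)^2)%C.
    2:{ rewrite (S_INR (S (S n))), RtoC_plus. simpl. ring. }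
    eapply Rle_trans. apply Cmod_triangle.
    rewrite !Cmod_mult, !Cmod_pow, Cmod_R, Rabs_pos_eq by apply pos_INR.
    set (d := Cmod (w - x)%C ^ 2) in *. assert (0 <= d) by apply pow2_ge_0.
    assert (Cmod x ^ S n <= t ^ S n) by (apply pow_incr; split; [apply Cmod_ge_0|auto]).
    pose proof (pos_INR (S (S n))). pose proof (pos_INR (S n)).
    apply Rle_trans with (t * (INR (S (S n)) * INR (S n) * t ^ n * d) + INR (S (S n)) * t ^ S n *
      d).
    + apply Rplus_le_compat.
      apply Rmult_le_compat; auto using Cmod_ge_0.
      apply Rmult_le_compat_r; auto. apply Rmult_le_compat_l; auto.
    + rewrite (S_INR (S (S n))), (S_INR (S n)) in *. simpl pow.
      assert (0 <= t * t ^ n * d). { apply Rmult_le_pos; auto. apply Rmult_le_pos; auto.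
      now apply pow_le. }
      set (p := INR (S n)) in *.
      nra.
Qed.

Lemma cseries_tail (u : nat -> C) (l : C) : cseries u l ->
  cseries (fun n => u (S n)) (l - u 0%nat)%C.
Proof.
  intros H. apply is_series_incr_1.
  assert (E : plus (l - u 0%nat)%C (u 0%nat) = l).
  { change (((l - u 0%nat) + u 0%nat)%C = l :> C). ring. }
  exact (eq_ind_r (fun x => cseries u x) H E).
Qed.

Lemma cseries_eq (u v : nat -> C) (l m : C) : cseries u l -> (forall n, u n = v n) -> l = m ->
  cseries v m.
Proof. intros H E <-. eapply is_series_ext; eauto. Qed.

Lemma cseries_minus (u v : nat -> C) (l m : C) : cseries u l -> cseries v m ->
  cseries (fun n => u n - v n)%C (l - m)%C.
Proof. intros. now apply (is_series_minus u v l m). Qed.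

Lemma cseries_scal (c : C) (u : nat -> C) (l : C) : cseries u l ->
  cseries (fun n => c * u n)%C (c * l)%C.
Proof. intros. now apply (is_series_scal c u l). Qed.

(** Two intermediate radii |h| < tau < rho < r: convergence at rho bounds the radius of
    convergence of the moduli, and at tau all the differentiated series converge absolutely.
    The difference quotient is then within K |w - h| of the derived series. *)
Lemma is_cderive_ps_sum a F r : (forall h, Cmod h < r -> ps_sum a h (F h)) ->
  forall h, Cmod h < r -> exists l, ps_sum (ps_deriv a) h l /\ is_cderive F h l.
Proof.
  intros HF h Hh.
  set (tau := (Cmod h + r) / 2). set (rho := (tau + r) / 2).
  pose proof (Cmod_ge_0 h) as Hh0.
  assert (Ht : Cmod h < tau < rho /\ rho < r) by (unfold rho, tau; lra).
  assert (HR : Rbar_lt tau (CV_radius (fun n => Cmod (a n)))).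
  { apply Rbar_lt_le_trans with rho. simpl; lra. eapply ps_sum_CV_radius. lra. apply HF.
    rewrite Cmod_R, Rabs_pos_eq; lra. }
  destruct (ex_ps_sum (ps_deriv a) h) as [l Hl].
  { rewrite CV_radius_ps_deriv. eapply Rbar_lt_trans; [|exact HR]. simpl; lra. }
  exists l. split. exact Hl.
  destruct (ex_series_Cmod_pow (ps_deriv (ps_deriv a)) tau) as [K HK]. lra.
  now rewrite !CV_radius_ps_deriv.
  assert (Q : forall w, Cmod w <= tau ->
    Cmod (F w - F h - l * (w - h))%C <= K * Cmod (w - h)%C ^ 2).
  (* The terms of degree 0 and 1 cancel exactly, so all three series are shifted past them. *)
  { intros w Hw.
    eapply (cseries_norm_le (fun n => a (S (S n)) *
      (w ^ S (S n) - h ^ S (S n) - RtoC (INR (S (S n))) * h ^ S n * (w - h)))%C).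
    - assert (Hw' : Cmod w < r) by lra.
      pose proof (cseries_tail _ _
        (cseries_tail _ _ (cseries_minus _ _ _ _ (HF w Hw') (HF h Hh)))) as S1.
      pose proof (cseries_scal (w - h)%C _ _ (cseries_tail _ _ Hl)) as S2.
      eapply cseries_eq. exact (cseries_minus _ _ _ _ S1 S2).
      + intros n. unfold ps_deriv. simpl. ring.
      + unfold ps_deriv. simpl. ring.
    - apply (is_series_scal_r (Cmod (w - h)%C ^ 2) _ _ HK).
    - intros n. simpl. rewrite Cmod_mult.
      rewrite !Cmod_ps_deriv. unfold PS_derive. rewrite Cmod_ps_deriv. unfold PS_derive.
      replace (INR (S n) * (INR (S (S n)) * Cmod (a (S (S n)))) * tau ^ n *
        (Cmod (w - h)%C * (Cmod (w - h)%C * 1))) with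
       (Cmod (a (S (S n))) * (INR (S (S n)) * INR (S n) * tau ^ n * Cmod (w - h)%C ^ 2))
         by (simpl pow; ring).
      apply Rmult_le_compat_l. apply Cmod_ge_0. apply pow_tangent_bound; lra. }
  assert (HK0 : 0 <= K).
  { apply Rle_trans with (Cmod (RtoC 0)). rewrite Cmod_0; lra.
    apply (cseries_norm_le (fun n => RtoC 0) (fun n => Cmod (ps_deriv (ps_deriv a) n) * tau ^ n)
      (RtoC 0) K); [|exact HK|].
    - apply (cseries_eq (fun n => RtoC 0 * (ps_deriv a n * h ^ n))%C _ (RtoC 0 * l)%C).
      apply cseries_scal, Hl. intros; ring. ring.
    - intros n. rewrite Cmod_0. apply Rmult_le_pos. apply Cmod_ge_0. apply pow_le; lra. }
  apply is_cderive_eps. intros eps He.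
  exists (Rmin (tau - Cmod h) (eps / (K + 1))). split.
  { apply Rmin_pos. lra. apply Rdiv_lt_0_compat; lra. }
  intros w Hw.
  assert (W1 : Cmod (w - h)%C < tau - Cmod h) by (eapply Rlt_le_trans; [exact Hw|apply Rmin_l]).
  assert (W2 : Cmod (w - h)%C < eps / (K + 1)) by (eapply Rlt_le_trans; [exact Hw|apply Rmin_r]).
  eapply Rle_trans. apply Q.
  { replace w with ((w - h) + h)%C by ring. eapply Rle_trans. apply Cmod_triangle. lra. }
  simpl. rewrite Rmult_1_r, <- Rmult_assoc. apply Rmult_le_compat_r. apply Cmod_ge_0.
  apply Rlt_le in W2. apply (Rmult_le_compat_r (K + 1)) in W2; [|lra].
  replace (eps / (K + 1) * (K + 1)) with eps in W2 by (field; lra).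
  pose proof (Cmod_ge_0 (w - h)%C). nra.
Qed.

Definition has_ps (f : C -> C) (z0 : C) (a : nat -> C) (r : R) : Prop :=
  forall z, Cmod (z - z0)%C < r -> ps_sum a (z - z0)%C (f z).

(** The derived series represents the derivative on the same disk, with no loss of radius.
    This is what lets the expansions of all the iterated derivatives be used together. *)
Lemma has_ps_derive f z0 a r : has_ps f z0 a r ->
  (forall z, Cmod (z - z0)%C < r -> is_cderive f z (C_derive f z)) /\
  has_ps (C_derive f) z0 (ps_deriv a) r.
Proof.
  intros H.
  assert (D : forall z, Cmod (z - z0)%C < r -> exists l, ps_sum (ps_deriv a) (z - z0)%C l
    /\ is_cderive f z l).
  { intros z Hz.
    destruct (is_cderive_ps_sum a (fun h => f (h + z0)%C) r)
      with (h := (z - z0)%C) as [l [Hl Dl]]; auto.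
    - intros h Hh. replace h with ((h + z0) - z0)%C at 1 by ring. apply H.
      now replace ((h + z0) - z0)%C with h by ring.
    - exists l. split; auto.
      rewrite is_cderive_eps in *. intros eps He. destruct (Dl eps He) as [d [Hd Hd']].
      exists d. split; auto. intros w Hw. specialize (Hd' (w - z0)%C).
      replace (w - z0 - (z - z0))%C with (w - z)%C in Hd' by ring.
      replace (w - z0 + z0)%C with w in Hd' by ring.
      replace (z - z0 + z0)%C with z in Hd' by ring. auto. }
  split; intros z Hz; destruct (D z Hz) as [l [Hl Dl]]; rewrite (is_cderive_C_derive _ _ _ Dl);
    auto.
Qed.

Lemma ps_sum_0 a : ps_sum a 0 (a 0%nat).
Proof.
  apply is_pseries_ps_sum. exact (@is_pseries_0 C_AbsRing C_NormedModule a).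
Qed.

Lemma ps_sum_unique a h l m : ps_sum a h l -> ps_sum a h m -> l = m.
Proof.
  intros H1 H2.
  exact (filterlim_locally_unique (F:=eventually) (V:=C_NormedModule) _ _ _ H1 H2).
Qed.

Lemma has_ps_center f z0 a r : 0 < r -> has_ps f z0 a r -> f z0 = a 0%nat.
Proof.
  intros Hr H. specialize (H z0). replace (z0 - z0)%C with (RtoC 0) in H by ring.
  rewrite Cmod_0 in H. eapply ps_sum_unique. apply H, Hr. apply ps_sum_0.
Qed.

Definition deriv_n (n : nat) (f : C -> C) : C -> C := Nat.iter n C_derive f.

Lemma deriv_n_S n f : deriv_n (S n) f = deriv_n n (C_derive f).
Proof. apply Nat.iter_succ_r. Qed.

Lemma deriv_n_center n : forall f z0 a r, 0 < r -> has_ps f z0 a r ->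
  deriv_n n f z0 = (RtoC (INR (fact n)) * a n)%C.
Proof.
  induction n as [|n IHn]; intros f z0 a r Hr H.
  - simpl. rewrite (has_ps_center _ _ _ _ Hr H). ring.
  - rewrite deriv_n_S. rewrite (IHn _ _ _ _ Hr (proj2 (has_ps_derive _ _ _ _ H))).
    unfold ps_deriv. rewrite fact_simpl, mult_INR, RtoC_mult. ring.
Qed.

Lemma has_ps_deriv_n n : forall f z0 a r, has_ps f z0 a r -> exists b, has_ps (deriv_n n f) z0 b r.
Proof.
  induction n as [|n IHn]; intros f z0 a r H. now exists a.
  rewrite deriv_n_S. apply (IHn _ _ (ps_deriv a)). now apply has_ps_derive.
Qed.

Lemma RtoC_INR_fact_neq n : RtoC (INR (fact n)) <> 0.
Proof. intros E. apply RtoC_inj in E. now apply (INR_fact_neq_0 n). Qed.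

(** Taylor's formula for every iterated derivative, on a disk that does not depend on the
    order of differentiation. *)
Lemma taylor_deriv_n n f z0 a r : 0 < r -> has_ps f z0 a r ->
  has_ps (deriv_n n f) z0 (fun k => deriv_n (n + k) f z0 / RtoC (INR (fact k)))%C r.
Proof.
  intros Hr H. destruct (has_ps_deriv_n n _ _ _ _ H) as [b Hb].
  intros z Hz. eapply cseries_eq; [exact (Hb z Hz)| |reflexivity].
  intros k. simpl. f_equal.
  replace (deriv_n (n + k) f z0) with (deriv_n k (deriv_n n f) z0).
  rewrite (deriv_n_center _ _ _ _ _ Hr Hb). field. apply RtoC_INR_fact_neq.
  unfold deriv_n. now rewrite Nat.add_comm, Nat.iter_add.
Qed.

Lemma analytic_at_has_ps f z0 : analytic_at f z0 <-> exists a r, 0 < r /\ has_ps f z0 a r.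
Proof.
  split.
  - intros [a [r H]]. exists a, r. split. apply cond_pos. intros z Hz.
    now apply is_pseries_ps_sum, H.
  - intros [a [r [Hr H]]]. exists a, (mkposreal r Hr). intros z Hz. apply is_pseries_ps_sum.
    now apply H.
Qed.

Lemma analytic_at_C_derive f z0 : analytic_at f z0 -> analytic_at (C_derive f) z0.
Proof.
  rewrite !analytic_at_has_ps. intros [a [r [Hr H]]]. exists (ps_deriv a), r. split; auto.
  now apply has_ps_derive.
Qed.

Lemma analytic_at_is_cderive f z0 : analytic_at f z0 -> is_cderive f z0 (C_derive f z0).
Proof.
  rewrite !analytic_at_has_ps. intros [a [r [Hr H]]]. apply (has_ps_derive _ _ _ _ H).
  replace (z0 - z0)%C with (RtoC 0) by ring. now rewrite Cmod_0.
Qed.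

(** * Quotients of analytic functions *)

(** The Cauchy product of absolutely convergent complex series, from the four real products of
    real and imaginary parts. *)
Lemma cseries_mult (u v : nat -> C) (l m : C) :
  cseries u l -> cseries v m ->
  ex_series (fun n => Cmod (u n)) -> ex_series (fun n => Cmod (v n)) ->
  cseries (fun n => sum_n (fun k => u k * v (n - k)%nat)%C n) (l * m)%C.
Proof.
  intros Hu Hv Au Av.
  apply is_series_C in Hu. apply is_series_C in Hv. destruct Hu as [Hu1 Hu2], Hv as [Hv1 Hv2].
  assert (Re_abs : forall w : nat -> C, ex_series (fun n => Cmod (w n)) ->
    ex_series (fun n => Rabs (Re (w n)))).
  { intros w. apply (@ex_series_le _ R_CompleteNormedModule). intros n.
    change (Rabs (Rabs (Re (w n))) <= Cmod (w n)).
    rewrite Rabs_Rabsolu. apply re_le_Cmod. }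
  assert (Im_abs : forall w : nat -> C, ex_series (fun n => Cmod (w n)) ->
    ex_series (fun n => Rabs (Im (w n)))).
  { intros w. apply (@ex_series_le _ R_CompleteNormedModule). intros n.
    change (Rabs (Rabs (Im (w n))) <= Cmod (w n)).
    rewrite Rabs_Rabsolu. apply im_le_Cmod. }
  apply is_series_C. split.
  - eapply is_series_ext; [|exact
      (is_series_minus _ _ _ _ (is_series_mult _ _ _ _ Hu1 Hv1 (Re_abs _ Au) (Re_abs _ Av))
        (is_series_mult _ _ _ _ Hu2 Hv2 (Im_abs _ Au) (Im_abs _ Av)))].
    intros n. rewrite sum_n_C. simpl Re. rewrite sum_n_Reals. symmetry. apply minus_sum.
  - eapply is_series_ext; [|exact
      (is_series_plus _ _ _ _ (is_series_mult _ _ _ _ Hu1 Hv2 (Re_abs _ Au) (Im_abs _ Av))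
        (is_series_mult _ _ _ _ Hu2 Hv1 (Im_abs _ Au) (Re_abs _ Av)))].
    intros n. rewrite sum_n_C. simpl Im. rewrite sum_n_Reals. symmetry. apply plus_sum.
Qed.

Section Quotient_coefficients.
Variables a c : nat -> C.

(** Dividing series needs course-of-values recursion: [quot_table n] tabulates the coefficients
    of the quotient up to index n. *)
Fixpoint quot_table (n : nat) : nat -> C :=
  match n with
  | O => fun _ => (a 0%nat / c 0%nat)%C
  | S m => fun k => if (k <=? m)%nat then quot_table m k
     else ((a (S m) - sum_n (fun k => quot_table m k * c (S m - k)%nat)%C m) / c 0%nat)%C
  end.

Definition quot_coeff (n : nat) : C := quot_table n n.

Lemma quot_table_coeff m k : (k <= m)%nat -> quot_table m k = quot_coeff k.
Proof.
  induction m as [|m IHm]; intros Hk.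
  - replace k with 0%nat by lia. reflexivity.
  - cbn -[Nat.leb Nat.sub]. destruct (Nat.leb_spec k m). auto.
    replace k with (S m) by lia. unfold quot_coeff. cbn -[Nat.leb Nat.sub].
    destruct (Nat.leb_spec (S m) m); [lia|reflexivity].
Qed.

Lemma quot_coeff_S m : quot_coeff (S m) =
  ((a (S m) - sum_n (fun k => quot_coeff k * c (S m - k)%nat)%C m) / c 0%nat)%C.
Proof.
  unfold quot_coeff at 1. cbn -[Nat.leb Nat.sub]. destruct (Nat.leb_spec (S m) m); [lia|].
  unfold Cdiv. do 2 f_equal. apply sum_n_ext_loc. intros k Hk. now rewrite quot_table_coeff.
Qed.

Hypothesis c0 : c 0%nat <> 0.

Lemma quot_coeff_convolution n : sum_n (fun k => quot_coeff k * c (n - k)%nat)%C n = a n.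
Proof.
  destruct n as [|m].
  - rewrite sum_O. unfold quot_coeff. simpl. now field.
  - rewrite sum_Sn, (quot_coeff_S m), Nat.sub_diag.
    set (s := sum_n _ m : C). change ((s + (a (S m) - s) / c 0%nat * c 0%nat)%C = a (S m)).
    now field.
Qed.

(** If L = 1 + q, then M sigma^n + q M sigma^n (1 + L + ... + L^(n-1)) = M sigma^n L^n, so the
    recursion reproduces the bound q (sigma L)^n exactly when q = M / |c 0|. *)
Lemma quot_coeff_bound (M sigma : R) : 0 <= M -> 0 <= sigma ->
  (forall n, Cmod (a n) <= M * sigma ^ n) -> (forall n, Cmod (c n) <= M * sigma ^ n) ->
  let q := M / Cmod (c 0%nat) in
  forall n, Cmod (quot_coeff n) <= q * (sigma * (1 + q)) ^ n.
Proof.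
  intros HM Hs Ha Hc q.
  assert (C0 : 0 < Cmod (c 0%nat)) by now apply Cmod_gt_0.
  assert (Hq : 0 <= q) by (apply Rmult_le_pos; [auto|apply Rlt_le, Rinv_0_lt_compat, C0]).
  assert (Hb : forall N m, (m <= N)%nat ->
    (forall k, (k <= m)%nat -> Cmod (quot_coeff k) <= q * (sigma * (1 + q)) ^ k) ->
    Cmod (sum_n (fun k => quot_coeff k * c (N - k)%nat)%C m) <=
      M * sigma ^ N * ((1 + q) ^ S m - 1)).
  { intros N m.
    assert (T : forall k, (k <= N)%nat -> Cmod (quot_coeff k) <= q * (sigma * (1 + q)) ^ k ->
       Cmod (quot_coeff k * c (N - k)%nat)%C <= M * sigma ^ N * (q * (1 + q) ^ k)).
    { intros k Hk Hk'. rewrite Cmod_mult.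
      eapply Rle_trans. apply Rmult_le_compat; try apply Cmod_ge_0. exact Hk'. apply Hc.
      rewrite Rpow_mult_distr. replace N with (k + (N - k))%nat at 2 by lia. rewrite pow_add.
      right; ring. }
    induction m as [|m IHm]; intros Hm Hk.
    - rewrite sum_O. eapply Rle_trans. apply T; auto. simpl. right; ring.
    - rewrite sum_Sn. eapply Rle_trans. apply Cmod_triangle.
      eapply Rle_trans. apply Rplus_le_compat. apply IHm; [lia|intros; apply Hk; lia].
      apply T; auto. simpl. right; ring. }
  intros n. induction n as [n IH] using (well_founded_induction Wf_nat.lt_wf). destruct n as [|m].
  - unfold quot_coeff. simpl. rewrite Cmod_div by auto. rewrite Rmult_1_r.
    apply Rmult_le_compat_r. apply Rlt_le, Rinv_0_lt_compat, C0. rewrite <- (Rmult_1_r M).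
    apply (Ha 0%nat).
  - rewrite quot_coeff_S, Cmod_div by auto.
    assert (E : Cmod (a (S m) - sum_n (fun k => quot_coeff k * c (S m - k)%nat) m)%C <=
      M * sigma ^ S m * (1 + q) ^ S m).
    { eapply Rle_trans. apply Cmod_triangle. rewrite Cmod_opp.
      eapply Rle_trans. apply Rplus_le_compat. apply Ha. apply Hb. lia. intros k Hk. apply IH. lia.
      right; ring. }
    rewrite Rpow_mult_distr. unfold q at 1. unfold Rdiv.
    replace (M * / Cmod (c 0%nat) * (sigma ^ S m * (1 + q) ^ S m))
      with (M * sigma ^ S m * (1 + q) ^ S m * / Cmod (c 0%nat)) by ring.
    apply Rmult_le_compat_r; auto. apply Rlt_le, Rinv_0_lt_compat, C0.
Qed.
End Quotient_coefficients.

Lemma has_ps_coeff_geom f z0 a r : 0 < r -> has_ps f z0 a r ->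
  exists M sigma, 0 <= M /\ 0 < sigma /\ forall n, Cmod (a n) <= M * sigma ^ n.
Proof.
  intros Hr H. pose proof (H (z0 + RtoC (r / 2))%C) as Hz.
  replace (z0 + RtoC (r / 2) - z0)%C with (RtoC (r / 2)) in Hz by ring.
  rewrite Cmod_R, Rabs_pos_eq in Hz by lra. specialize (Hz ltac:(lra)).
  apply cseries_terms_bounded in Hz. destruct Hz as [M HM].
  exists M, (/ (r / 2)). split; [|split].
  - eapply Rle_trans; [apply Cmod_ge_0|apply (HM 0%nat)].
  - apply Rinv_0_lt_compat; lra.
  - intros n. specialize (HM n). rewrite Cmod_mult, Cmod_pow, Cmod_R, Rabs_pos_eq in HM by lra.
    assert (0 < (r / 2) ^ n) by (apply pow_lt; lra).
    rewrite pow_inv. apply (Rmult_le_reg_r ((r / 2) ^ n)); auto.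
    rewrite Rmult_assoc, Rinv_l; lra.
Qed.

Lemma ex_series_Cmod_geom a h M K : (forall n, Cmod (a n) <= M * K ^ n) -> 0 <= K ->
  K * Cmod h < 1 ->
  ex_series (fun n => Cmod (a n * h ^ n)%C).
Proof.
  intros Ha HK Hh.
  apply (@ex_series_le _ R_CompleteNormedModule) with (b := fun n => M * (K * Cmod h) ^ n).
  - intros n. change (Rabs (Cmod (a n * h ^ n)%C) <= M * (K * Cmod h) ^ n).
    rewrite Rabs_pos_eq by apply Cmod_ge_0.
    rewrite Cmod_mult, Cmod_pow, Rpow_mult_distr, <- Rmult_assoc. apply Rmult_le_compat_r.
    apply pow_le, Cmod_ge_0. auto.
  - apply (@ex_series_scal R_AbsRing R_NormedModule M (fun n => (K * Cmod h) ^ n)).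
    apply ex_series_geom. rewrite Rabs_pos_eq; auto. apply Rmult_le_pos; auto using Cmod_ge_0.
Qed.

Lemma is_cderive_continuous f z l : is_cderive f z l ->
  forall eps, 0 < eps -> exists d, 0 < d /\ forall w, Cmod (w - z)%C < d ->
    Cmod (f w - f z)%C < eps.
Proof.
  intros H eps He. rewrite is_cderive_eps in H.
  destruct (H 1 Rlt_0_1) as [d [Hd Hd']].
  pose proof (Cmod_ge_0 l) as Hl.
  exists (Rmin d (eps / (Cmod l + 1))). split.
  - apply Rmin_pos; auto. apply Rdiv_lt_0_compat; lra.
  - intros w Hw. specialize (Hd' w (Rlt_le_trans _ _ _ Hw (Rmin_l _ _))).
    replace (f w - f z)%C with ((f w - f z - l * (w - z)) + l * (w - z))%C by ring.
    eapply Rle_lt_trans. apply Cmod_triangle. rewrite Cmod_mult.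
    pose proof (Rlt_le_trans _ _ _ Hw (Rmin_r _ _)) as W.
    apply (Rmult_lt_compat_r (Cmod l + 1)) in W; [|lra].
    replace (eps / (Cmod l + 1) * (Cmod l + 1)) with eps in W by (field; lra). lra.
Qed.

(** On a disk where both series and the quotient series converge absolutely and f does not
    vanish, the Cauchy product of the quotient series with that of f is the series of u. *)
Lemma analytic_at_div u f z0 : analytic_at u z0 -> analytic_at f z0 -> f z0 <> 0 ->
  analytic_at (fun z => u z / f z)%C z0.
Proof.
  intros Hu Hf Hf0.
  destruct (is_cderive_continuous _ _ _ (analytic_at_is_cderive _ _ Hf) (Cmod (f z0))) as
    [d [Hd Hnz]]. now apply Cmod_gt_0.
  rewrite analytic_at_has_ps in *.
  destruct Hu as [a [r1 [Hr1 Ha]]], Hf as [c [r2 [Hr2 Hc]]].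
  rewrite (has_ps_center _ _ _ _ Hr2 Hc) in Hf0.
  destruct (has_ps_coeff_geom _ _ _ _ Hr1 Ha) as [M1 [s1 [HM1 [Hs1 B1]]]].
  destruct (has_ps_coeff_geom _ _ _ _ Hr2 Hc) as [M2 [s2 [HM2 [Hs2 B2]]]].
  set (M := Rmax M1 M2). set (s := Rmax s1 s2).
  assert (HM : 0 <= M) by (eapply Rle_trans; [exact HM1|apply Rmax_l]).
  assert (Hs : 0 < s) by (eapply Rlt_le_trans; [exact Hs1|apply Rmax_l]).
  assert (W : forall x t n, 0 <= x <= M -> 0 < t <= s -> x * t ^ n <= M * s ^ n).
  { intros x t n Hx Ht. apply Rmult_le_compat; try lra. apply pow_le; lra. apply pow_incr; lra. }
  assert (Ba : forall n, Cmod (a n) <= M * s ^ n).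
  { intros n. eapply Rle_trans. apply B1. apply W; split; auto; apply Rmax_l. }
  assert (Bc : forall n, Cmod (c n) <= M * s ^ n).
  { intros n. eapply Rle_trans. apply B2. apply W; split; auto; apply Rmax_r. }
  pose proof (quot_coeff_bound a c Hf0 M s HM (Rlt_le _ _ Hs) Ba Bc) as Bb. cbv zeta in Bb.
  set (q := M / Cmod (c 0%nat)) in *.
  assert (Hq : 0 <= q) by (apply Rmult_le_pos; [auto|apply Rlt_le, Rinv_0_lt_compat;
    now apply Cmod_gt_0]).
  set (K := s * (1 + q)) in *.
  assert (HK : s <= K) by (unfold K; nra).
  assert (HKi : 0 < / K) by (apply Rinv_0_lt_compat; lra).
  set (r := Rmin (Rmin r1 r2) (Rmin d (/ K))).
  assert (Hr : r <= r1 /\ r <= r2 /\ r <= d /\ r <= / K).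
  { unfold r. pose proof (Rmin_l (Rmin r1 r2) (Rmin d (/ K))).
    pose proof (Rmin_r (Rmin r1 r2) (Rmin d (/ K))).
    pose proof (Rmin_l r1 r2). pose proof (Rmin_r r1 r2). pose proof (Rmin_l d (/ K)).
    pose proof (Rmin_r d (/ K)). lra. }
  exists (quot_coeff a c), r. split. { unfold r; repeat apply Rmin_pos; auto. }
  intros z Hz. set (h := (z - z0)%C) in *.
  assert (Hk : K * Cmod h < 1). { replace 1 with (K * / K) by (field; lra).
  apply Rmult_lt_compat_l; lra. }
  assert (Ab : ex_series (fun n => Cmod (quot_coeff a c n * h ^ n)%C))
    by (apply (ex_series_Cmod_geom _ _ q K); auto; lra).
  assert (Ac : ex_series (fun n => Cmod (c n * h ^ n)%C)).
  { apply (ex_series_Cmod_geom _ _ M s); auto; try lra. pose proof (Cmod_ge_0 h). nra. }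
  destruct (ex_cseries_abs _ Ab) as [l Hl].
  assert (Hcz : ps_sum c h (f z)) by (apply Hc; fold h; lra).
  pose proof (cseries_mult _ _ _ _ Hl Hcz Ab Ac) as P.
  assert (Hz0 : f z <> 0).
  { intros E. specialize (Hnz z ltac:(fold h; lra)). rewrite E in Hnz.
    replace (0 - f z0)%C with (- f z0)%C in Hnz by ring. rewrite Cmod_opp in Hnz. lra. }
  assert (E : u z = (l * f z)%C).
  { apply (ps_sum_unique a h). apply Ha; fold h; lra.
    eapply cseries_eq; [exact P| |reflexivity]. intros n.
    rewrite <- (quot_coeff_convolution a c Hf0 n).
    assert (G : forall m, (m <= n)%nat ->
      sum_n (fun k => quot_coeff a c k * h ^ k * (c (n - k)%nat * h ^ (n - k)))%C m =
       (sum_n (fun k => quot_coeff a c k * c (n - k)%nat) m * h ^ n)%C).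
    { assert (X : forall k, (k <= n)%nat -> (h ^ n = h ^ k * h ^ (n - k))%C).
      { intros k Hkn. replace n with (k + (n - k))%nat at 1 by lia. apply Cpow_add_r. }
      induction m as [|m IHm]; intros Hm.
      - rewrite !sum_O. rewrite (X 0%nat Hm). simpl. ring.
      - rewrite !sum_Sn, IHm by lia.
        set (A := sum_n _ m : C).
        change ((A * h ^ n + quot_coeff a c (S m) * h ^ (S m) * (c (n - S m)%nat * h ^ (n - S m)) =
           (A + quot_coeff a c (S m) * c (n - S m)%nat) * h ^ n)%C). rewrite (X (S m) Hm). ring. }
    apply G. lia. }
  replace (u z / f z)%C with l. exact Hl. rewrite E. now field.
Qed.

(** * Functions with non-negative Maclaurin coefficients *)

(** The supremum of the t up to which P holds throughout is attained by the closure hypothesis,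
    and cannot be smaller than b by the openness hypothesis. *)
Lemma real_induction (P : R -> Prop) (b : R) : 0 < b ->
  P 0 ->
  (forall t, 0 <= t < b -> P t -> exists d, 0 < d /\ forall u, t < u < t + d -> P u) ->
  (forall t, 0 < t < b -> (forall u, 0 <= u < t -> P u) -> P t) ->
  forall t, 0 <= t < b -> P t.
Proof.
  intros Hb H0 Hopen Hclosed T HT.
  set (S := fun x => 0 <= x <= T /\ forall u, 0 <= u <= x -> P u).
  destruct (completeness S) as [s [Hub Hlub]].
  - exists T. intros x [Hx _]. lra.
  - exists 0. split. lra. intros u Hu. now replace u with 0 by lra.
  - assert (Hs0 : 0 <= s). { apply Hub. split. lra. intros u Hu. now replace u with 0 by lra. }
    assert (HsT : s <= T). { apply Hlub. intros x [Hx _]. lra. }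
    assert (Hbelow : forall u, 0 <= u < s -> P u).
    { intros u Hu. destruct (Classical_Prop.classic (P u)) as [|N]; auto. exfalso.
      assert (s <= u); [|lra]. apply Hlub. intros x [Hx Hxu]. destruct (Rle_lt_dec x u); auto.
      exfalso. apply N, Hxu. lra. }
    assert (Hs : P s). { destruct (Rle_lt_dec s 0). now replace s with 0 by lra.
    apply Hclosed; auto; lra. }
    destruct (Rle_lt_dec T s) as [|L]. { now replace T with s by lra. }
    exfalso. destruct (Hopen s) as [d [Hd Hd']]; auto. lra.
    set (x := Rmin T (s + d / 2)).
    assert (s < x) by (apply Rmin_glb_lt; lra).
    assert (x <= T) by apply Rmin_l. assert (x <= s + d / 2) by apply Rmin_r.
    assert (x <= s); [|lra]. apply Hub. split. lra.
    intros u Hu. destruct (Rtotal_order u s) as [|[->|]]; auto. apply Hbelow; lra. apply Hd'; lra.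
Qed.

Lemma analytic_at_deriv_n n f z : analytic_at f z -> analytic_at (deriv_n n f) z.
Proof. intros H. induction n as [|n IHn]; simpl; auto. now apply analytic_at_C_derive. Qed.

Lemma Cmod_RtoC_mult_unit t e : 0 <= t -> Cmod e = 1 -> Cmod (RtoC t * e)%C = t.
Proof. intros Ht He. rewrite Cmod_mult, He, Cmod_R, Rabs_pos_eq; lra. Qed.

Section Majorant.
Variable g : C -> C.
Hypothesis g_an : analytic_on_disk g.
Variable e : C.
Hypothesis e_unit : Cmod e = 1.

Let dominated (t : R) : Prop :=
  forall n, Cmod (deriv_n n g (RtoC t * e)%C) <= Re (deriv_n n g (RtoC t)).

(** The Taylor expansions at t e and at t have increments of the same modulus u - t, and their
    coefficients are compared by the hypothesis at t for all orders. *)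
Lemma dominated_right t : 0 <= t < 1 -> dominated t ->
  exists d, 0 < d /\ forall u, t < u < t + d -> dominated u.
Proof.
  intros Ht Hdom.
  destruct (proj1 (analytic_at_has_ps _ _)
    (g_an (RtoC t * e)%C ltac:(unfold unit_disk; rewrite Cmod_RtoC_mult_unit; lra)))
    as [a [r1 [Hr1 Ha]]].
  destruct (proj1 (analytic_at_has_ps _ _)
    (g_an (RtoC t) ltac:(unfold unit_disk; rewrite Cmod_R, Rabs_pos_eq; lra)))
    as [b [r2 [Hr2 Hb]]].
  exists (Rmin r1 r2). split. now apply Rmin_pos.
  intros u Hu n. pose proof (Rmin_l r1 r2). pose proof (Rmin_r r1 r2).
  pose proof (taylor_deriv_n n _ _ _ _ Hr1 Ha (RtoC u * e)%C) as T1.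
  pose proof (taylor_deriv_n n _ _ _ _ Hr2 Hb (RtoC u)) as T2.
  replace (RtoC u * e - RtoC t * e)%C with (RtoC (u - t) * e)%C in T1 by (rewrite RtoC_minus; ring).
  rewrite <- RtoC_minus in T2.
  rewrite Cmod_RtoC_mult_unit in T1 by (auto; lra). rewrite Cmod_R, Rabs_pos_eq in T2 by lra.
  specialize (T1 ltac:(lra)). specialize (T2 ltac:(lra)).
  apply (cseries_norm_le _ _ _ _ T1 (proj1 (proj1 (is_series_C _ _) T2))).
  intros k. rewrite Cmod_mult, Cmod_pow, Cmod_RtoC_mult_unit by (auto; lra).
  rewrite <- RtoC_pow, re_scal_r. apply Rmult_le_compat_r. apply pow_le; lra.
  rewrite Cmod_div by apply RtoC_INR_fact_neq. unfold Cdiv.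
  rewrite <- RtoC_inv, re_scal_r by apply INR_fact_neq_0.
  rewrite Cmod_R, Rabs_pos_eq by apply pos_INR.
  apply Rmult_le_compat_r. apply Rlt_le, Rinv_0_lt_compat, INR_fact_lt_0. apply Hdom.
Qed.

Lemma dominated_closed t : 0 < t < 1 -> (forall u, 0 <= u < t -> dominated u) -> dominated t.
Proof.
  intros Ht Hdom n.
  destruct (Rle_lt_dec (Cmod (deriv_n n g (RtoC t * e)%C)) (Re (deriv_n n g (RtoC t)))) as [|L];
    auto.
  exfalso. set (eps := (Cmod (deriv_n n g (RtoC t * e)%C) - Re (deriv_n n g (RtoC t))) / 2).
  assert (He : 0 < eps) by (unfold eps; lra).
  destruct (is_cderive_continuous _ _ _
    (analytic_at_is_cderive _ _ (analytic_at_deriv_n n g (RtoC t * e)%C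
    (g_an (RtoC t * e)%C ltac:(unfold unit_disk; rewrite Cmod_RtoC_mult_unit; lra)))) eps He) as
      [d1 [Hd1 C1]].
  destruct (is_cderive_continuous _ _ _
    (analytic_at_is_cderive _ _ (analytic_at_deriv_n n g (RtoC t)
    (g_an (RtoC t) ltac:(unfold unit_disk; rewrite Cmod_R, Rabs_pos_eq; lra)))) eps He) as
      [d2 [Hd2 C2]].
  set (k := Rmin t (Rmin d1 d2) / 2).
  assert (Hk : 0 < k /\ k < t /\ k < d1 /\ k < d2).
  { pose proof (Rmin_l t (Rmin d1 d2)). pose proof (Rmin_r t (Rmin d1 d2)).
    pose proof (Rmin_l d1 d2). pose proof (Rmin_r d1 d2).
    assert (0 < Rmin t (Rmin d1 d2)) by (repeat apply Rmin_pos; lra). unfold k. lra. }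
  specialize (C1 (RtoC (t - k) * e)%C). specialize (C2 (RtoC (t - k))).
  replace (RtoC (t - k) * e - RtoC t * e)%C with (- (RtoC k * e))%C in C1
    by (rewrite RtoC_minus; ring).
  replace (RtoC (t - k) - RtoC t)%C with (- RtoC k)%C in C2 by (rewrite RtoC_minus; ring).
  rewrite Cmod_opp, Cmod_RtoC_mult_unit in C1 by (auto; lra).
  rewrite Cmod_opp, Cmod_R, Rabs_pos_eq in C2 by lra.
  specialize (C1 ltac:(lra)). specialize (C2 ltac:(lra)).
  specialize (Hdom (t - k) ltac:(lra) n).
  set (X := deriv_n n g (RtoC t * e)%C) in *. set (Y := deriv_n n g (RtoC t)) in *.
  set (X' := deriv_n n g (RtoC (t - k) * e)%C) in *. set (Y' := deriv_n n g (RtoC (t - k))) in *.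
  pose proof (Cmod_triangle X' (- (X' - X))%C) as T.
  replace (X' + - (X' - X))%C with X in T by ring.
  rewrite Cmod_opp in T.
  pose proof (re_le_Cmod (Y' - Y)%C) as Q. apply Rabs_le_between in Q. unfold Cminus in Q.
  rewrite re_plus, re_opp in Q.
  fold (Y' - Y)%C in Q. unfold eps in *. lra.
Qed.

(** At t = 0 both sides are the same derivative, which is a non-negative real. *)
Lemma deriv_n_dominated : (forall n, Im (deriv_n n g (RtoC 0)) = 0
  /\ 0 <= Re (deriv_n n g (RtoC 0))) ->
  forall t, 0 <= t < 1 -> forall n, Cmod (deriv_n n g (RtoC t * e)%C) <= Re (deriv_n n g (RtoC t)).
Proof.
  intros H0. apply (real_induction dominated 1); try lra.
  - intros n. replace (RtoC 0 * e)%C with (RtoC 0) by ring. destruct (H0 n) as [I N].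
    set (w := deriv_n n g (RtoC 0)) in *.
    replace w with (RtoC (Re w)). rewrite Cmod_R, re_RtoC, Rabs_pos_eq; lra.
    destruct w as [x y]. simpl in *. now subst.
  - apply dominated_right.
  - apply dominated_closed.
Qed.
End Majorant.

Lemma Cpolar z : exists e, Cmod e = 1 /\ z = (RtoC (Cmod z) * e)%C.
Proof.
  destruct (Ceq_dec z 0) as [->|N].
  - exists 1. split. apply Cmod_1. rewrite Cmod_0. ring.
  - assert (H : Cmod z <> 0) by (intros E; apply N, Cmod_eq_0, E).
    assert (H' : RtoC (Cmod z) <> 0) by (intros E; apply RtoC_inj in E; auto).
    exists (z / RtoC (Cmod z))%C. split.
    rewrite Cmod_div, Cmod_R, Rabs_pos_eq by (auto; apply Cmod_ge_0). now field.
    now field.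
Qed.

Lemma nonneg_maclaurin_majorant g : analytic_on_disk g -> nonneg_maclaurin g ->
  forall z, unit_disk z -> Cmod (g z) <= Re (g (RtoC (Cmod z))).
Proof.
  intros Hg Hn z Hz. destruct (Cpolar z) as [e [He Ez]]. rewrite Ez at 1.
  apply (deriv_n_dominated g Hg e He) with (n := 0%nat).
  - intros n. destruct (Hn n) as [I N]. unfold maclaurin_coeff in *. fold (deriv_n n g) in *.
    unfold Cdiv in *. rewrite <- RtoC_inv in I, N by apply INR_fact_neq_0. rewrite re_scal_r in N.
    pose proof (INR_fact_lt_0 n) as F. pose proof (Rinv_0_lt_compat _ F) as F'.
    split.
    + rewrite im_mult in I. simpl in I. rewrite Rmult_0_r, Rplus_0_l in I.
      apply Rmult_integral in I. destruct I; auto; lra.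
    + apply (Rmult_le_reg_r (/ INR (fact n))); auto. lra.
  - split. apply Cmod_ge_0. exact Hz.
Qed.

(** * The mean over a circle and the derivative at the centre *)

(** The Cauchy-Riemann equations: the real differential of f is multiplication by l. *)
Lemma is_cderive_differentiable_pt f x y l : is_cderive f (x, y) l ->
  differentiable_pt_lim (fun u v => Re (f (u, v))) x y (Re l) (- Im l) /\
  differentiable_pt_lim (fun u v => Im (f (u, v))) x y (Im l) (Re l).
Proof.
  intros H. rewrite is_cderive_eps in H.
  assert (K : forall eps : posreal, exists d : posreal, forall u v, Rabs (u - x) < d ->
    Rabs (v - y) < d ->
     Cmod (f (u, v) - f (x, y) - l * ((u, v) - (x, y)))%C <=
       eps * Rmax (Rabs (u - x)) (Rabs (v - y))).
  { intros [eps He]. destruct (H (eps / 2)) as [d [Hd Hd']]. lra.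
    assert (Hd2 : 0 < d / 2) by lra. exists (mkposreal _ Hd2). intros u v Hu Hv. simpl in Hu, Hv.
    assert (S2 : sqrt 2 <= 2). { rewrite <- (sqrt_square 2) at 2 by lra. apply sqrt_le_1; lra. }
    pose proof (Cmod_2Rmax ((u, v) - (x, y))%C) as M. simpl fst in M; simpl snd in M.
    assert (0 <= Rmax (Rabs (u + - x)) (Rabs (v + - y)))
      by (eapply Rle_trans; [apply Rabs_pos|apply Rmax_l]).
    assert (Rmax (Rabs (u + - x)) (Rabs (v + - y)) < d / 2) by (apply Rmax_lub_lt; auto).
    assert (M2 : Cmod ((u, v) - (x, y))%C <= 2 * Rmax (Rabs (u + - x)) (Rabs (v + - y))).
    { eapply Rle_trans. exact M. now apply Rmult_le_compat_r. }
    eapply Rle_trans. apply Hd'. lra. simpl. unfold Rminus. nra. }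
  split; intros eps; destruct (K eps) as [d Hd]; exists d; intros u v Hu Hv;
    refine (Rle_trans _ _ _ _ (Hd u v Hu Hv)).
  - eapply Rle_trans; [|apply re_le_Cmod]. right. f_equal. destruct l as [l1 l2].
    destruct (f (u, v)), (f (x, y)). simpl. ring.
  - eapply Rle_trans; [|apply im_le_Cmod]. right. f_equal. destruct l as [l1 l2].
    destruct (f (u, v)), (f (x, y)). simpl. ring.
Qed.

Lemma is_cderive_curve f (x y : R -> R) t x' y' l : is_cderive f (x t, y t) l ->
  is_derive x t x' -> is_derive y t y' ->
  is_derive (fun s => Re (f (x s, y s))) t (Re (l * (x', y'))) /\
  is_derive (fun s => Im (f (x s, y s))) t (Im (l * (x', y'))).
Proof.
  intros Hf Hx Hy. destruct (is_cderive_differentiable_pt _ _ _ _ Hf) as [H1 H2].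
  apply is_derive_Reals in Hx. apply is_derive_Reals in Hy.
  split; apply is_derive_Reals.
  - replace (Re (l * (x', y'))) with (Re l * x' + - Im l * y') by (destruct l; simpl; ring).
    exact (derivable_pt_lim_comp_2d _ _ _ _ _ _ _ _ H1 Hx Hy).
  - replace (Im (l * (x', y'))) with (Im l * x' + Re l * y') by (destruct l; simpl; ring).
    exact (derivable_pt_lim_comp_2d _ _ _ _ _ _ _ _ H2 Hx Hy).
Qed.

Definition cis (t : R) : C := (cos t, sin t).

Notation ccontinuous := (@continuous (AbsRing_UniformSpace C_AbsRing)
  (AbsRing_UniformSpace C_AbsRing)).

Lemma Cmod_cis t : Cmod (cis t) = 1.
Proof.
  unfold Cmod, cis. simpl. transitivity (sqrt 1); [f_equal|apply sqrt_1].
  pose proof (sin2_cos2 t). unfold Rsqr in H. lra.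
Qed.

(** The derivative is carried along explicitly because the functions of this kind are composites
    with Moebius maps, whose derivatives come out as formulas. *)
Definition C1_on_disk (f f' : C -> C) : Prop :=
  forall z, unit_disk z -> is_cderive f z (f' z) /\ ccontinuous f' z.

Section Circle_mean.
Variables psi psi' : C -> C.
Hypothesis psi_C1 : C1_on_disk psi psi'.

(** For z = r e^(i t), [rotRe] and [rotIm] are the real and imaginary parts of e^(-i t) psi(z),
    and [radial] is Re psi'(z).  The rotation by e^(-i t) extracts the first Taylor coefficient
    of psi when one averages over t. *)
Let circ (r t : R) : C := (r * cos t, r * sin t).
Let rotRe (r t : R) : R := Re (psi (circ r t)) * cos t + Im (psi (circ r t)) * sin t.
Let rotIm (r t : R) : R := Im (psi (circ r t)) * cos t - Re (psi (circ r t)) * sin t.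
Let radial (r t : R) : R := Re (psi' (circ r t)).

Lemma circ_disk r t : -1 < r < 1 -> unit_disk (circ r t).
Proof.
  intros Hr. unfold unit_disk. replace (circ r t) with (RtoC r * cis t)%C.
  rewrite Cmod_mult, Cmod_cis, Cmod_R, Rmult_1_r. apply Rabs_def1; lra.
  unfold circ, cis, Cmult, RtoC; simpl. f_equal; ring.
Qed.

(** d/dr (e^(-i t) psi(r e^(i t))) = psi'(r e^(i t)). *)
Lemma rotRe_derive_r r t : -1 < r < 1 -> is_derive (fun s => rotRe s t) r (radial r t).
Proof.
  intros Hr. destruct (psi_C1 _ (circ_disk r t Hr)) as [Hd _].
  destruct (is_cderive_curve psi (fun s => s * cos t) (fun s => s * sin t) r (cos t) (sin t)
    (psi' (circ r t)) Hd) as [H1 H2];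
    try (auto_derive; auto; ring).
  evar_last.
  apply (is_derive_plus (V:=R_NormedModule)).
  apply (is_derive_scal_l (V:=R_NormedModule)). exact H1.
  apply (is_derive_scal_l (V:=R_NormedModule)). exact H2.
  unfold radial, circ, plus, scal; simpl. unfold mult; simpl. pose proof (sin2_cos2 t) as E.
  unfold Rsqr in E.
  set (p := psi' _) in *. destruct p as [p1 p2]. simpl.
  replace p1 with (p1 * (sin t * sin t + cos t * cos t)) at 3 by (rewrite E; ring). ring.
Qed.

(** d/dt (e^(-i t) psi(z)) = i (r psi'(z) - e^(-i t) psi(z)); the imaginary part of this relates
    the angular derivative of [rotIm] to the radial one of [rotRe]. *)
Lemma rot_derive_t r t : -1 < r < 1 ->
  (exists u, is_derive (fun s => rotRe r s) t u)
    /\ is_derive (fun s => rotIm r s) t (r * radial r t - rotRe r t).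
Proof.
  intros Hr. destruct (psi_C1 _ (circ_disk r t Hr)) as [Hd _].
  destruct (is_cderive_curve psi (fun s => r * cos s) (fun s => r * sin s) t (- r * sin t)
    (r * cos t) (psi' (circ r t)) Hd) as [H1 H2];
    try (auto_derive; auto; ring).
  split.
  - eexists. unfold rotRe.
    apply (is_derive_plus (V:=R_NormedModule)); apply (is_derive_mult (K:=R_AbsRing)).
    exact H1. apply is_derive_cos. apply Rmult_comm. exact H2. apply is_derive_sin.
    apply Rmult_comm.
  - evar_last. unfold rotIm.
    apply (is_derive_minus (V:=R_NormedModule)); apply (is_derive_mult (K:=R_AbsRing)).
    exact H2. apply is_derive_cos. apply Rmult_comm. exact H1. apply is_derive_sin.
    apply Rmult_comm.
    unfold radial, rotRe, circ, minus, plus, opp, mult; simpl. unfold mult; simpl.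
    pose proof (sin2_cos2 t) as E. unfold Rsqr in E.
    set (p := psi' _) in *. destruct p as [p1 p2]. set (q := psi _). destruct q as [q1 q2]. simpl.
    replace (r * p1) with (r * p1 * (sin t * sin t + cos t * cos t)) by (rewrite E; ring). ring.
Qed.

Lemma radial_continuous r t : -1 < r < 1 -> continuity_2d_pt radial r t.
Proof.
  intros Hr. destruct (psi_C1 _ (circ_disk r t Hr)) as [_ Hc].
  intros eps.
  destruct (proj1 (filterlim_locally _ _) Hc eps) as [d Hd].
  assert (Cx : continuity_2d_pt (fun r t => r * cos t) r t).
  { apply continuity_2d_pt_mult. apply continuity_2d_pt_id1.
    apply (continuity_1d_2d_pt_comp cos (fun _ t => t)). apply continuity_cos.
    apply continuity_2d_pt_id2. }
  assert (Cy : continuity_2d_pt (fun r t => r * sin t) r t).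
  { apply continuity_2d_pt_mult. apply continuity_2d_pt_id1.
    apply (continuity_1d_2d_pt_comp sin (fun _ t => t)). apply continuity_sin.
    apply continuity_2d_pt_id2. }
  assert (Hd2 : 0 < d / 2) by (pose proof (cond_pos d); lra).
  generalize (locally_2d_and _ _ _ _ (Cx (mkposreal _ Hd2)) (Cy (mkposreal _ Hd2))).
  apply locally_2d_impl. apply locally_2d_forall. intros u v [Hu Hv]. simpl in Hu, Hv.
  assert (B : Cmod (circ u v - circ r t)%C < d).
  { eapply Rle_lt_trans. apply Cmod_le_Re_Im. unfold circ; simpl. unfold Rminus in *. lra. }
  eapply Rle_lt_trans; [|exact (Hd (circ u v) B)].
  change (Rabs (radial u v - radial r t) <= Cmod (psi' (circ u v) - psi' (circ r t))%C).
  eapply Rle_trans; [|apply re_le_Cmod]. right. reflexivity.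
Qed.

Lemma radial_continuous_t r t : -1 < r < 1 -> continuous (radial r) t.
Proof.
  intros Hr. apply continuity_pt_filterlim. intros eps He.
  destruct (radial_continuous r t Hr (mkposreal eps He)) as [d Hd].
  exists d. split. apply cond_pos. intros x [_ Hx]. apply (Hd r x).
  rewrite Rminus_diag, Rabs_R0. apply cond_pos. exact Hx.
Qed.

Lemma rotRe_ex_RInt r : -1 < r < 1 -> ex_RInt (rotRe r) 0 (2 * PI).
Proof.
  intros Hr. apply (ex_RInt_continuous (V:=R_CompleteNormedModule)). intros t _.
  apply (ex_derive_continuous (V:=R_NormedModule)). apply rot_derive_t, Hr.
Qed.

Let circle_int (r : R) : R := RInt (rotRe r) 0 (2 * PI).

(** [rotIm] is periodic in t, so its t-derivative r [radial] - [rotRe] integrates to 0. *)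
Lemma circle_int_eq r : -1 < r < 1 -> circle_int r = r * RInt (radial r) 0 (2 * PI).
Proof.
  intros Hr.
  assert (H : is_RInt (fun t => r * radial r t - rotRe r t) 0 (2 * PI)
    (minus (rotIm r (2 * PI)) (rotIm r 0))).
  { apply (is_RInt_derive (V:=R_CompleteNormedModule)).
    - intros t _. now apply rot_derive_t.
    - intros t _. apply (continuous_minus (V:=R_NormedModule)).
      apply (continuous_scal_r (V:=R_NormedModule)). now apply radial_continuous_t.
      apply (ex_derive_continuous (V:=R_NormedModule)). apply rot_derive_t, Hr. }
  replace (minus (rotIm r (2 * PI)) (rotIm r 0)) with 0 in H.
  2:{ unfold rotIm, circ. rewrite cos_2PI, sin_2PI, cos_0, sin_0. unfold minus, plus, opp; simpl.
      ring. }
  assert (HD : is_RInt (radial r) 0 (2 * PI) (RInt (radial r) 0 (2 * PI))).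
  { apply (RInt_correct (V:=R_CompleteNormedModule)),
      (ex_RInt_continuous (V:=R_CompleteNormedModule)).
    intros t _. now apply radial_continuous_t. }
  pose proof (RInt_correct (V:=R_CompleteNormedModule) _ _ _ (rotRe_ex_RInt r Hr)) as HU.
  pose proof (is_RInt_minus (V:=R_NormedModule) _ _ _ _ _ _
    (is_RInt_scal (V:=R_NormedModule) _ _ _ r _ HD) HU) as HM.
  apply (is_RInt_unique (V:=R_CompleteNormedModule)) in H.
  apply (is_RInt_unique (V:=R_CompleteNormedModule)) in HM.
  unfold circle_int. unfold minus, plus, opp, scal in H, HM; simpl in H, HM.
  unfold mult in HM; simpl in HM.
  unfold Rminus in H. rewrite H in HM. lra.
Qed.

Lemma circle_int_derive r : -1 < r < 1 -> is_derive circle_int r (RInt (radial r) 0 (2 * PI)).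
Proof.
  intros Hr.
  assert (L : locally r (fun s => -1 < s < 1)).
  { apply (open_and (fun s => -1 < s) (fun s => s < 1)); auto. apply open_gt. apply open_lt. }
  rewrite <- (RInt_ext (fun t => Derive (fun s => rotRe s t) r)).
  2:{ intros t _. now apply is_derive_unique, rotRe_derive_r. }
  apply is_derive_RInt_param.
  - revert L. apply filter_imp. intros s Hs t _. exists (radial s t). now apply rotRe_derive_r.
  - intros t _. apply continuity_2d_pt_ext_loc with radial; [|now apply radial_continuous].
    destruct L as [d Hd]. exists d. intros u v Hu _. symmetry.
    apply is_derive_unique, rotRe_derive_r. now apply Hd.
  - revert L. apply filter_imp. intros s Hs. now apply rotRe_ex_RInt.
Qed.

(** For A = [circle_int], the two previous lemmas say A(r) = r A'(r); hence A(r) / r is constant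
    for r > 0, and equal to its limit A'(0) = 2 pi Re psi'(0). *)
Lemma circle_int_linear r : 0 < r < 1 -> circle_int r = r * (2 * PI * Re (psi' 0)).
Proof.
  assert (D0 : RInt (radial 0) 0 (2 * PI) = 2 * PI * Re (psi' 0)).
  { rewrite (RInt_ext _ (fun _ => Re (psi' 0))). rewrite RInt_const.
    unfold scal; simpl; unfold mult; simpl. ring.
    intros t _. unfold radial, circ. now rewrite !Rmult_0_l. }
  intros Hr.
  assert (K : forall x, 0 < x < 1 -> circle_int x / x = circle_int r / r).
  { intros x Hx.
    assert (Z : forall y, 0 < y < 1 -> is_derive (fun y => circle_int y / y) y 0).
    { intros y Hy. evar_last. apply is_derive_div. apply circle_int_derive. lra.
      apply is_derive_id. lra.
      rewrite circle_int_eq by lra. unfold one; simpl. field. lra. }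
    destruct (MVT_gen (fun y => circle_int y / y) r x (fun _ => 0)) as [c [_ Hc]].
    - intros y Hy. apply Z. unfold Rmin, Rmax in Hy. destruct (Rle_dec r x); lra.
    - intros y Hy. apply continuity_pt_filterlim.
      apply (ex_derive_continuous (V:=R_NormedModule) (fun y => circle_int y / y)). exists 0.
      apply Z. unfold Rmin, Rmax in Hy. destruct (Rle_dec r x); lra.
    - lra. }
  pose proof (circle_int_derive 0 ltac:(lra)) as H. rewrite D0 in H.
  apply is_derive_Reals in H. set (m := 2 * PI * Re (psi' 0)) in *.
  assert (A0 : circle_int 0 = 0) by (rewrite circle_int_eq by lra; ring).
  assert (E : circle_int r / r = m).
  { apply cond_eq. intros eps He. destruct (H eps He) as [d Hd].
    set (h := Rmin (d / 2) (1 / 2)).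
    assert (Hh : 0 < h < 1 /\ h < d). { pose proof (cond_pos d).
    pose proof (Rmin_l (d / 2) (1 / 2)). pose proof (Rmin_r (d / 2) (1 / 2)).
       assert (0 < h) by (apply Rmin_pos; lra). unfold h in *. lra. }
    specialize (Hd h ltac:(lra)). rewrite Rabs_pos_eq in Hd by lra. specialize (Hd ltac:(lra)).
    rewrite Rplus_0_l, A0, Rminus_0_r in Hd. rewrite K in Hd by lra. exact Hd. }
  rewrite <- E. field. lra.
Qed.

Hypothesis psi_le1 : forall z, unit_disk z -> Cmod (psi z) <= 1.

Lemma Re_deriv_0_le_1 : Re (psi' 0) <= 1.
Proof.
  assert (B : forall r, 0 < r < 1 -> r * Re (psi' 0) <= 1).
  { intros r Hr. pose proof PI_RGT_0.
    assert (Hle : circle_int r <= 2 * PI).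
    { replace (2 * PI) with (RInt (fun _ => 1) 0 (2 * PI))
        by (rewrite RInt_const; unfold scal; simpl; unfold mult; simpl; ring).
      apply RInt_le. lra. apply rotRe_ex_RInt; lra. apply (ex_RInt_const (V:=R_NormedModule)).
      intros t _.
      replace (rotRe r t) with (Re (psi (circ r t) * Cconj (cis t)))
        by (unfold rotRe, cis; destruct (psi (circ r t)); simpl; ring).
      eapply Rle_trans. apply Rle_abs. eapply Rle_trans. apply re_le_Cmod.
      rewrite Cmod_mult, Cmod_conj, Cmod_cis, Rmult_1_r.
      apply psi_le1, circ_disk; lra. }
    rewrite circle_int_linear in Hle by auto. apply (Rmult_le_reg_l (2 * PI)). lra. lra. }
  destruct (Rle_lt_dec (Re (psi' 0)) 1) as [|L]; auto. exfalso.
  set (m := Re (psi' 0)) in *.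
  assert (Hr : 0 < 2 / (1 + m) < 1). { split. apply Rdiv_lt_0_compat; lra.
  apply Rmult_lt_reg_r with (1 + m). lra. unfold Rdiv. rewrite Rmult_assoc, Rinv_l; lra. }
  (* If m = Re psi'(0) > 1, the radius 2 / (1 + m) < 1 already gives r m > 1. *)
  specialize (B _ Hr). apply (Rmult_le_compat_r (1 + m)) in B; [|lra].
  replace (2 / (1 + m) * m * (1 + m)) with (2 * m) in B by (field; lra). lra.
Qed.
End Circle_mean.

(** * The Schwarz-Pick and Schwarz lemmas *)

Lemma is_cderive_mult f g z df dg : is_cderive f z df -> is_cderive g z dg ->
  is_cderive (fun w => f w * g w)%C z (df * g z + f z * dg)%C.
Proof. intros Hf Hg. exact (is_derive_mult (K:=C_AbsRing) f g z df dg Hf Hg Cmult_comm). Qed.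

Lemma is_cderive_comp f g z df dg : is_cderive f (g z) df -> is_cderive g z dg ->
  is_cderive (fun w => f (g w)) z (df * dg)%C.
Proof.
  intros Hf Hg.
  pose proof (is_derive_comp (K:=C_AbsRing) (V:=AbsRing_NormedModule C_AbsRing) f g z df dg Hf
    Hg) as H.
  replace (df * dg)%C with (dg * df)%C by ring. exact H.
Qed.

Lemma is_cderive_const (c : C) z : is_cderive (fun _ => c) z (RtoC 0).
Proof. exact (is_derive_const (K:=C_AbsRing) (V:=AbsRing_NormedModule C_AbsRing) c z). Qed.

Lemma is_cderive_scal (c : C) f z l : is_cderive f z l ->
  is_cderive (fun w => c * f w)%C z (c * l)%C.
Proof.
  intros H. pose proof (is_cderive_mult (fun _ => c) f z _ _ (is_cderive_const c z) H) as M.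
  replace (c * l)%C with (0 * f z + c * l)%C by ring. exact M.
Qed.

Lemma is_cderive_id z : is_cderive (fun w => w) z (RtoC 1).
Proof. exact (is_derive_id (K:=C_AbsRing) z). Qed.

Lemma is_cderive_plus f g z df dg : is_cderive f z df -> is_cderive g z dg ->
  is_cderive (fun w => f w + g w)%C z (df + dg)%C.
Proof.
  intros Hf Hg.
  exact (is_derive_plus (K:=C_AbsRing) (V:=AbsRing_NormedModule C_AbsRing) f g z df dg Hf Hg).
Qed.

Lemma is_cderive_ccontinuous f z l : is_cderive f z l -> ccontinuous f z.
Proof.
  intros H. apply (ex_derive_continuous (K:=C_AbsRing) (V:=AbsRing_NormedModule C_AbsRing)).
  now exists l.
Qed.

Lemma ccontinuous_mult f g z : ccontinuous f z -> ccontinuous g z ->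
  ccontinuous (fun w => f w * g w)%C z.
Proof. intros Hf Hg. exact (continuous_mult (K:=C_AbsRing) f g z Hf Hg). Qed.

Lemma is_cderive_inv (z : C) : z <> 0 -> is_cderive Cinv z (- / (z * z))%C.
Proof.
  intros Hz. assert (Z : 0 < Cmod z) by now apply Cmod_gt_0.
  apply is_cderive_eps. intros eps He.
  exists (Rmin (Cmod z / 2) (eps * Cmod z ^ 3 / 2)). split.
  { apply Rmin_pos. lra. apply Rdiv_lt_0_compat; [|lra]. apply Rmult_lt_0_compat; auto.
    now apply pow_lt. }
  intros w Hw.
  pose proof (Rlt_le_trans _ _ _ Hw (Rmin_l _ _)) as W1.
  pose proof (Rlt_le_trans _ _ _ Hw (Rmin_r _ _)) as W2.
  assert (W : Cmod z / 2 < Cmod w).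
  { pose proof (Cmod_triangle w (- (w - z))%C) as T. rewrite Cmod_opp in T.
    replace (w + - (w - z))%C with z in T by ring. lra. }
  assert (Hw0 : w <> 0) by (apply Cmod_gt_0; lra).
  replace (/ w - / z - - / (z * z) * (w - z))%C with ((w - z) * (w - z) / (z * z * w))%C
    by (field; auto).
  rewrite Cmod_div by (repeat apply Cmult_neq_0; auto). rewrite !Cmod_mult.
  apply (Rmult_le_reg_r (Cmod z * Cmod z * Cmod w)). repeat apply Rmult_lt_0_compat; lra.
  unfold Rdiv.
  rewrite Rmult_assoc, Rinv_l by (apply Rgt_not_eq; repeat apply Rmult_lt_0_compat; lra).
  rewrite Rmult_1_r.
  replace (eps * Cmod (w - z)%C * (Cmod z * Cmod z * Cmod w))
    with (Cmod (w - z)%C * (eps * Cmod z ^ 2 * Cmod w)) by ring.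
  apply Rmult_le_compat_l. apply Cmod_ge_0.
  apply Rlt_le. eapply Rlt_le_trans. exact W2.
  replace (eps * Cmod z ^ 3 / 2) with (eps * Cmod z ^ 2 * (Cmod z / 2)) by field.
  apply Rmult_le_compat_l; [|lra]. apply Rmult_le_pos. lra. apply pow2_ge_0.
Qed.

Lemma C1_comp f f' g g' : C1_on_disk f f' -> C1_on_disk g g' -> (forall z, unit_disk z ->
  unit_disk (g z)) ->
  C1_on_disk (fun z => f (g z)) (fun z => f' (g z) * g' z)%C.
Proof.
  intros Hf Hg HD z Hz. destruct (Hg z Hz) as [G1 G2]. destruct (Hf _ (HD z Hz)) as [F1 F2].
  split. now apply is_cderive_comp.
  apply ccontinuous_mult; auto.
  apply (continuous_comp (U:=AbsRing_UniformSpace C_AbsRing) (V:=AbsRing_UniformSpace C_AbsRing)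
    (W:=AbsRing_UniformSpace C_AbsRing) g f'); auto. eapply is_cderive_ccontinuous, G1.
Qed.

Lemma analytic_C1 f : analytic_on_disk f -> C1_on_disk f (C_derive f).
Proof.
  intros H z Hz. split. now apply analytic_at_is_cderive, H.
  eapply is_cderive_ccontinuous, analytic_at_is_cderive, analytic_at_C_derive, H, Hz.
Qed.

(** A rotation of psi turns |psi'(0)| into Re psi'(0). *)
Lemma cauchy_deriv_bound psi psi' : C1_on_disk psi psi' -> (forall z, unit_disk z ->
  Cmod (psi z) <= 1) ->
  Cmod (psi' 0) <= 1.
Proof.
  intros H1 Hb. destruct (Cpolar (psi' 0)) as [e [He E]].
  replace (Cmod (psi' 0)) with (Re (Cconj e * psi' 0)).
  apply (Re_deriv_0_le_1 (fun z => Cconj e * psi z)%C (fun z => Cconj e * psi' z)%C).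
  - intros z Hz. destruct (H1 z Hz) as [D1 D2]. split.
    + now apply is_cderive_scal.
    + apply (ccontinuous_mult (fun _ => Cconj e)); auto.
      eapply is_cderive_ccontinuous, is_cderive_const.
  - intros z Hz. rewrite Cmod_mult, Cmod_conj, He. rewrite Rmult_1_l. auto.
  - rewrite E at 1.
    replace (Cconj e * (RtoC (Cmod (psi' 0)) * e))%C
      with (RtoC (Cmod (psi' 0)) * (e * Cconj e))%C by ring.
    rewrite <- Cmod2_conj, He. rewrite re_scal_l. simpl. ring.
Qed.

(** The disk automorphism taking 0 to a. *)
Definition mobius (a z : C) : C := ((z + a) / (1 + Cconj a * z))%C.

Definition mobius' (a z : C) :
  C := (RtoC (1 - Cmod a ^ 2) * (/ (1 + Cconj a * z) * / (1 + Cconj a * z)))%C.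

Lemma mobius_denom a z : unit_disk a -> unit_disk z -> (1 + Cconj a * z)%C <> 0.
Proof.
  unfold unit_disk. intros Ha Hz E.
  assert (Q : Cmod (Cconj a * z)%C = 1).
  { replace (Cconj a * z)%C with (- (1))%C. apply Cmod_m1.
    replace (Cconj a * z)%C with ((1 + Cconj a * z) - 1)%C by ring. rewrite E. ring. }
  rewrite Cmod_mult, Cmod_conj in Q. pose proof (Cmod_ge_0 a). pose proof (Cmod_ge_0 z). nra.
Qed.

Lemma mobius_disk a z : unit_disk a -> unit_disk z -> unit_disk (mobius a z).
Proof.
  intros Ha Hz. pose proof (mobius_denom a z Ha Hz) as N. unfold unit_disk, mobius in *.
  rewrite Cmod_div by auto. apply Cmod_gt_0 in N.
  apply (Rmult_lt_reg_r (Cmod (1 + Cconj a * z)%C)); auto.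
  unfold Rdiv. rewrite Rmult_assoc, Rinv_l, Rmult_1_r, Rmult_1_l by lra.
  assert (E : Cmod (1 + Cconj a * z)%C ^ 2 - Cmod (z + a)%C ^ 2 =
    (1 - Cmod a ^ 2) * (1 - Cmod z ^ 2)).
  { rewrite !Cmod2_alt. destruct a, z; simpl; ring. }
  pose proof (Cmod_ge_0 a). pose proof (Cmod_ge_0 z).
  assert (0 < (1 - Cmod a ^ 2) * (1 - Cmod z ^ 2)) by (apply Rmult_lt_0_compat; nra).
  pose proof (Cmod_ge_0 (z + a)%C). nra.
Qed.

Lemma mobius_C1 a : unit_disk a -> C1_on_disk (mobius a) (mobius' a).
Proof.
  intros Ha z Hz. pose proof (mobius_denom a z Ha Hz) as N.
  assert (Dd : forall z, is_cderive (fun w => 1 + Cconj a * w)%C z (Cconj a)).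
  { intros w. evar_last.
    apply (is_cderive_plus (fun _ => RtoC 1)). apply is_cderive_const.
    apply (is_cderive_scal _ (fun w => w)), is_cderive_id.
    change (0 + Cconj a * 1 = Cconj a)%C. ring. }
  assert (Di : is_cderive (fun w => / (1 + Cconj a * w))%C z
    (- / ((1 + Cconj a * z) * (1 + Cconj a * z)) * Cconj a)%C).
  { apply (is_cderive_comp Cinv). now apply is_cderive_inv. apply Dd. }
  split.
  - evar_last.
    apply (is_cderive_mult (fun w => w + a)%C (fun w => / (1 + Cconj a * w))%C);
      [apply (is_cderive_plus (fun w => w) (fun _ => a))|exact Di].
    apply is_cderive_id. apply is_cderive_const.
    change ((1 + 0) * / (1 + Cconj a * z) + (z + a) *
      (- / ((1 + Cconj a * z) * (1 + Cconj a * z)) * Cconj a) = mobius' a z)%C.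
    unfold mobius'. rewrite RtoC_minus, Cmod2_conj. field. exact N.
  - apply (ccontinuous_mult (fun _ => RtoC (1 - Cmod a ^ 2))).
    eapply is_cderive_ccontinuous, is_cderive_const.
    apply (ccontinuous_mult (fun w => / (1 + Cconj a * w))%C (fun w => / (1 + Cconj a * w))%C);
      eapply is_cderive_ccontinuous, Di.
Qed.

(** Conjugating w by Moebius maps, from 0 to the given point a and from b = w a to 0, gives a
    self-map of the disk with derivative w'(a) (1 - |a|^2) / (1 - |b|^2) at 0. *)
Lemma schwarz_pick w w' : C1_on_disk w w' -> (forall z, unit_disk z -> unit_disk (w z)) ->
  forall z, unit_disk z -> Cmod (w' z) * (1 - Cmod z ^ 2) <= 1 - Cmod (w z) ^ 2.
Proof.
  intros H1 HD a Ha. set (b := w a). assert (Hb : unit_disk b) by now apply HD.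
  assert (Hb' : unit_disk (- b)%C) by (unfold unit_disk; now rewrite Cmod_opp).
  assert (M : mobius a 0 = a)
    by (unfold mobius; field; intros E; apply (f_equal fst) in E; simpl in E; lra).
  pose proof (C1_comp _ _ _ _ H1 (mobius_C1 a Ha) (fun z => mobius_disk a z Ha)) as K1.
  pose proof (C1_comp _ _ _ _ (mobius_C1 _ Hb') K1 (fun z Hz => HD _ (mobius_disk a z Ha Hz))) as
    K2.
  apply cauchy_deriv_bound in K2.
  2:{ intros z Hz. apply Rlt_le, (mobius_disk (- b)%C); auto. apply HD. now apply mobius_disk. }
  cbv beta in K2. rewrite M in K2. fold b in K2. unfold mobius' in K2.
  assert (Hb2 : 0 < 1 - Cmod b ^ 2) by (unfold unit_disk in Hb; pose proof (Cmod_ge_0 b); nra).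
  assert (Ha2 : 0 < 1 - Cmod a ^ 2) by (unfold unit_disk in Ha; pose proof (Cmod_ge_0 a); nra).
  replace (1 + Cconj (- b) * b)%C with (RtoC (1 - Cmod b ^ 2)) in K2.
  2:{ rewrite Cmod2_alt. destruct b; unfold Cconj, Copp, Cplus, Cmult, RtoC; simpl; f_equal; ring. }
  replace (1 + Cconj a * 0)%C with (RtoC 1) in K2 by ring.
  rewrite Cmod_opp, <- !RtoC_inv in K2 by lra.
  rewrite !Cmod_mult, !Cmod_R in K2. rewrite Rinv_1, Rabs_R1 in K2.
  rewrite (Rabs_pos_eq (1 - Cmod b ^ 2)), (Rabs_pos_eq (1 - Cmod a ^ 2)),
    (Rabs_pos_eq (/ _)) in K2 by (try apply Rlt_le, Rinv_0_lt_compat; lra).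
  apply (Rmult_le_compat_r (1 - Cmod b ^ 2)) in K2; [|lra].
  apply Rle_trans with (1 * (1 - Cmod b ^ 2)); [|lra].
  eapply Rle_trans; [|exact K2]. right. field. lra.
Qed.

(** Let v(t) be the component of w(t e) in the direction of w(z), where z = |z| e.  Schwarz-Pick
    gives v' (1 - t^2) <= 1 - v^2, which says that the pseudo-hyperbolic expression
    k = (v - t) / (1 - v t) is non-increasing; it vanishes at t = 0, so v <= t at t = |z|. *)
Lemma schwarz w w' : C1_on_disk w w' -> (forall z, unit_disk z -> unit_disk (w z)) -> w 0 = 0 ->
  forall z, unit_disk z -> Cmod (w z) <= Cmod z.
Proof.
  intros H1 HD H0 z Hz.
  destruct (Cpolar z) as [e [He Ez]]. destruct (Cpolar (w z)) as [c [Hc Ec]].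
  set (rho := Cmod z) in *. assert (Hrho : 0 <= rho < 1) by (split; [apply Cmod_ge_0|exact Hz]).
  set (G := fun s : C => (Cconj c * w s)%C).
  set (v := fun t => Re (G (t * Re e, t * Im e))).
  set (dv := fun t => Re (Cconj c * w' (RtoC t * e)%C * e)).
  assert (Ept : forall t : R, (t * Re e, t * Im e) = (RtoC t * e)%C)
    by (intros t; destruct e; unfold Cmult, RtoC; simpl; f_equal; ring).
  assert (HDt : forall t, 0 <= t <= rho -> unit_disk (RtoC t * e)%C)
    by (intros t Ht; unfold unit_disk; rewrite Cmod_RtoC_mult_unit; lra).
  assert (Dv : forall t, 0 <= t <= rho -> is_derive v t (dv t)).
  { intros t Ht. destruct (H1 _ (HDt t Ht)) as [D1 _].
    assert (DG : is_cderive G (t * Re e, t * Im e) (Cconj c * w' (RtoC t * e)%C)%C).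
    { rewrite Ept. now apply is_cderive_scal. }
    destruct (is_cderive_curve G (fun t => t * Re e) (fun t => t * Im e) t (Re e) (Im e) _ DG) as
      [R1 _]; try (auto_derive; auto; ring).
    unfold dv. now replace e with (Re e, Im e) at 2 by (destruct e; reflexivity). }
  assert (Bv : forall t, 0 <= t <= rho -> v t < 1 /\ dv t * (1 - t ^ 2) <= 1 - v t ^ 2).
  { intros t Ht. pose proof (schwarz_pick w w' H1 HD _ (HDt t Ht)) as SP.
    rewrite Cmod_RtoC_mult_unit in SP by (auto; lra).
    assert (V : Rabs (v t) <= Cmod (w (RtoC t * e)%C)).
    { unfold v, G. rewrite Ept. eapply Rle_trans. apply re_le_Cmod.
      rewrite Cmod_mult, Cmod_conj, Hc. lra. }
    assert (dV : Rabs (dv t) <= Cmod (w' (RtoC t * e)%C)).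
    { unfold dv. eapply Rle_trans. apply re_le_Cmod. rewrite !Cmod_mult, Cmod_conj, Hc, He. lra. }
    pose proof (HD _ (HDt t Ht)) as W. unfold unit_disk in W.
    pose proof (Rle_abs (v t)). pose proof (Rle_abs (dv t)). split. lra.
    assert (v t ^ 2 <= Cmod (w (RtoC t * e)%C) ^ 2). { rewrite <- pow2_abs. apply pow_incr.
    split; auto. apply Rabs_pos. }
    assert (0 <= 1 - t ^ 2) by nra. nra. }
  assert (V0 : v 0 = 0). { unfold v, G. rewrite Ept. replace (0 * e)%C with (RtoC 0) by ring.
  rewrite H0. replace (Cconj c * 0)%C with (RtoC 0) by ring. reflexivity. }
  assert (Vr : v rho = Cmod (w z)).
  { unfold v, G. rewrite Ept, <- Ez. rewrite Ec at 1.
    replace (Cconj c * (RtoC (Cmod (w z)) * c))%C with (RtoC (Cmod (w z)) * (c * Cconj c))%C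
      by ring.
    rewrite <- Cmod2_conj, Hc. rewrite re_scal_l. simpl. ring. }
  set (k := fun t => (v t - t) / (1 - v t * t)).
  assert (Dk : forall t, 0 <= t <= rho -> exists d, is_derive k t d /\ d <= 0).
  { intros t Ht. destruct (Bv t Ht) as [B1 B2].
    assert (P : 0 < 1 - v t * t) by (destruct (Rle_lt_dec 0 (v t)); nra).
    eexists. split.
    unfold k. apply is_derive_div. apply (is_derive_minus (V:=R_NormedModule)). apply Dv, Ht.
    apply (is_derive_id (K:=R_AbsRing)).
    apply (is_derive_minus (V:=R_NormedModule)).
    apply (is_derive_const (K:=R_AbsRing)(V:=R_NormedModule)).
    apply (is_derive_mult (K:=R_AbsRing)). apply Dv, Ht. apply (is_derive_id (K:=R_AbsRing)).
    apply Rmult_comm. lra.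
    unfold minus, plus, opp, zero, one; simpl. unfold plus, mult; simpl. unfold Rdiv.
    assert (0 < / ((1 - v t * t) * ((1 - v t * t) * 1)))
      by (apply Rinv_0_lt_compat; rewrite Rmult_1_r; now apply Rmult_lt_0_compat).
    set (i := / _) in *. nra. }
  assert (K : k rho <= k 0).
  { destruct (MVT_gen k 0 rho (fun t => Derive k t)) as [x [Hx E]].
    - intros t Ht. rewrite Rmin_left, Rmax_right in Ht by lra. destruct (Dk t) as [d [Hd _]]. lra.
      apply Derive_correct. now exists d.
    - intros t Ht. rewrite Rmin_left, Rmax_right in Ht by lra. destruct (Dk t) as [d [Hd _]]. lra.
      apply continuity_pt_filterlim, (ex_derive_continuous (V:=R_NormedModule) k). now exists d.
    - rewrite Rmin_left, Rmax_right in Hx by lra. destruct (Dk x Hx) as [d [Hd Hd0]].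
      rewrite (is_derive_unique _ _ _ Hd) in E. nra. }
  unfold k in K. rewrite V0, Vr in K.
  destruct (Bv rho ltac:(lra)) as [B1 _]. rewrite Vr in B1.
  assert (P : 0 < 1 - Cmod (w z) * rho) by (pose proof (Cmod_ge_0 (w z)); nra).
  apply (Rmult_le_compat_r (1 - Cmod (w z) * rho)) in K; [|lra].
  unfold Rdiv in K. rewrite Rmult_assoc, Rinv_l in K by lra. lra.
Qed.

(** * The pre-Schwarzian norm *)

Lemma is_cderive_ext_disk F G z l : unit_disk z -> (forall w, unit_disk w -> F w = G w) ->
  is_cderive F z l -> is_cderive G z l.
Proof.
  intros Hz E H. rewrite is_cderive_eps in *. intros eps He. destruct (H eps He) as [d [Hd Hd']].
  unfold unit_disk in *.
  exists (Rmin d (1 - Cmod z)). split. apply Rmin_pos; lra.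
  intros w Hw. rewrite <- !E; auto.
  - apply Hd'. eapply Rlt_le_trans; [exact Hw|apply Rmin_l].
  - pose proof (Rlt_le_trans _ _ _ Hw (Rmin_r _ _)). replace w with ((w - z) + z)%C by ring.
    eapply Rle_lt_trans. apply Cmod_triangle. lra.
Qed.

Lemma is_cderive_unique F z l m : is_cderive F z l -> is_cderive F z m -> l = m.
Proof. intros H1 H2. rewrite <- (is_cderive_C_derive _ _ _ H1). now apply is_cderive_C_derive. Qed.

Lemma analytic_at_minus_const f c z0 : analytic_at f z0 -> analytic_at (fun z => f z - c)%C z0.
Proof.
  rewrite !analytic_at_has_ps. intros [a [r [Hr H]]].
  exists (fun n => match n with O => a 0%nat - c | S _ => a n end)%C, r. split; auto.
  intros z Hz. pose proof (cseries_tail _ _ (H z Hz)) as T. cbv beta in T.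
  apply (is_series_decr_1 (K:=C_AbsRing) (V:=C_NormedModule)).
  eapply cseries_eq. exact T. reflexivity.
  match goal with |- _ = plus ?x (opp ?y) => change (f z - a 0%nat * (z - z0) ^ 0 = x - y)%C end.
  simpl. ring.
Qed.

Lemma unit_disk_0 : unit_disk 0.
Proof. unfold unit_disk. rewrite Cmod_0. lra. Qed.

(** The limit s -> 0+ of a bound on the positive real axis. *)
Lemma Re_le_at_0 (F : C -> C) (l : C) (M : R) : is_cderive F (RtoC 0) l ->
  (forall s : R, 0 < s < 1 -> Re (F (RtoC s)) <= M) -> Re (F 0) <= M.
Proof.
  intros H HM. destruct (Rle_lt_dec (Re (F 0)) M) as [|L]; auto. exfalso.
  destruct (is_cderive_continuous _ _ _ H (Re (F 0) - M)) as [d [Hd Hd']]. lra.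
  set (s := Rmin d 1 / 2).
  assert (Hs : 0 < s < 1 /\ s < d). { pose proof (Rmin_l d 1). pose proof (Rmin_r d 1).
  assert (0 < Rmin d 1) by (apply Rmin_pos; lra). unfold s. lra. }
  specialize (Hd' (RtoC s)). replace (RtoC s - 0)%C with (RtoC s) in Hd' by ring.
  rewrite Cmod_R, Rabs_pos_eq in Hd' by lra.
  specialize (Hd' ltac:(lra)). specialize (HM s ltac:(lra)).
  pose proof (re_le_Cmod (F (RtoC s) - F 0)%C) as Q. apply Rabs_le_between in Q.
  unfold Cminus in Q. rewrite re_plus, re_opp in Q. fold (F (RtoC s) - F 0)%C in Q. lra.
Qed.

Section Pre_schwarzian.
Variables phi f omega : C -> C.
Hypothesis phi_an : analytic_on_disk phi.
Hypothesis phi_pos : forall z, unit_disk z -> 0 < Re (phi z).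
Hypothesis f_A : class_A f.
Hypothesis f_nz : forall z, unit_disk z -> z <> RtoC 0 -> f z <> RtoC 0.
Hypothesis om_an : analytic_on_disk omega.
Hypothesis om_disk : forall z, unit_disk z -> unit_disk (omega z).
Hypothesis om_0 : omega (RtoC 0) = RtoC 0.
Hypothesis sub : forall z, unit_disk z -> starlike_quotient f z = phi (omega z).

Lemma phi_nz z : unit_disk z -> phi z <> 0.
Proof. intros Hz E. specialize (phi_pos z Hz). rewrite E in phi_pos. simpl in phi_pos. lra. Qed.

(** Clearing denominators yields an identity between analytic functions that holds at the origin
    too and can be differentiated by the product rule. *)
Lemma starlike_eq z : unit_disk z -> (z * C_derive f z = f z * phi (omega z))%C.
Proof.
  intros Hz. rewrite <- sub by auto. unfold starlike_quotient.
  destruct (Ceq_dec z (RtoC 0)) as [->|N].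
  - destruct f_A as [_ [-> _]]. ring.
  - field. now apply f_nz.
Qed.

Lemma starlike_deriv_nz z : unit_disk z -> C_derive f z <> 0.
Proof.
  intros Hz E. destruct (Ceq_dec z 0) as [->|N].
  - destruct f_A as [_ [_ E1]]. rewrite E1 in E. apply (f_equal fst) in E. simpl in E. lra.
  - pose proof (starlike_eq z Hz) as S. rewrite E, Cmult_0_r in S. symmetry in S. revert S.
    apply Cmult_neq_0. now apply f_nz. apply phi_nz. now apply om_disk.
Qed.

Lemma pre_schwarzian_eq z : unit_disk z -> z <> 0 ->
  pre_schwarzian f z = (C_derive phi (omega z) / phi (omega z) * C_derive omega z +
    (phi (omega z) - 1) / z)%C.
Proof.
  intros Hz N.
  pose proof (starlike_eq z Hz) as S.
  pose proof (f_nz z Hz N) as Nf. pose proof (phi_nz _ (om_disk z Hz)) as Np.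
  pose proof (starlike_deriv_nz z Hz) as Nd.
  destruct f_A as [f_an _].
  assert (L : is_cderive (fun w => w * C_derive f w)%C z
    (1 * C_derive f z + z * C_derive (C_derive f) z)%C).
  { apply (is_cderive_mult (fun w => w)). apply is_cderive_id.
    now apply analytic_at_is_cderive, analytic_at_C_derive, f_an. }
  assert (Rr : is_cderive (fun w => f w * phi (omega w))%C z
    (C_derive f z * phi (omega z) + f z * (C_derive phi (omega z) * C_derive omega z))%C).
  { apply (is_cderive_mult f (fun w => phi (omega w))). now apply analytic_at_is_cderive, f_an.
    apply (is_cderive_comp phi omega). now apply analytic_at_is_cderive, phi_an, om_disk.
    now apply analytic_at_is_cderive, om_an. }
  apply (is_cderive_ext_disk _ (fun w => f w * phi (omega w))%C) in L; auto; [|exact starlike_eq].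
  pose proof (is_cderive_unique _ _ _ _ L Rr) as E.
  unfold pre_schwarzian.
  set (A := C_derive (C_derive f) z) in *. set (d := C_derive f z) in *.
  set (p := phi (omega z)) in *.
  set (dp := C_derive phi (omega z)) in *. set (dw := C_derive omega z) in *.
  assert (EA : A = ((d * p + f z * (dp * dw) - d) / z)%C) by (rewrite <- E; field; auto).
  assert (Ef : f z = (z * d / p)%C) by (rewrite S; field; auto).
  rewrite EA, Ef. field. auto.
Qed.

Let P z := (C_derive phi z / phi z)%C.
Let Q z := (phi z - RtoC 1)%C.
Hypothesis P_nonneg : nonneg_maclaurin P.
Hypothesis Q_nonneg : nonneg_maclaurin Q.
Hypothesis phi_0 : phi (RtoC 0) = RtoC 1.

Lemma P_analytic : analytic_on_disk P.
Proof.
  intros z Hz. apply analytic_at_div. now apply analytic_at_C_derive, phi_an.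
  now apply phi_an. now apply phi_nz.
Qed.

Lemma Q_analytic : analytic_on_disk Q.
Proof. intros z Hz. now apply analytic_at_minus_const, phi_an. Qed.

Lemma bound_at_eq s : bound_at phi s = (1 - s ^ 2) / s * (s * Re (P (RtoC s)) + Re (Q (RtoC s))).
Proof.
  unfold bound_at. f_equal. rewrite <- re_scal_l, <- re_plus. f_equal. unfold P, Q, Cdiv. ring.
Qed.

Lemma P_Q_ge_0 s : 0 <= s < 1 -> 0 <= Re (P (RtoC s)) /\ 0 <= Re (Q (RtoC s)).
Proof.
  intros Hs.
  assert (D : unit_disk (RtoC s)) by (unfold unit_disk; rewrite Cmod_R, Rabs_pos_eq; lra).
  assert (E : Cmod (RtoC s) = s) by (rewrite Cmod_R, Rabs_pos_eq; lra).
  split; [pose proof (nonneg_maclaurin_majorant P P_analytic P_nonneg _ D) as H|pose proof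
    (nonneg_maclaurin_majorant Q Q_analytic Q_nonneg _ D) as H];
   rewrite E in H; eapply Rle_trans; try exact H; apply Cmod_ge_0.
Qed.

(** Proved first for z <> 0, with a separate limiting argument when omega z = 0; the resulting
    bound on the punctured disk then extends to z = 0 by continuity. *)
Lemma pre_schwarzian_bound M : (forall s, 0 < s < 1 -> bound_at phi s <= M) ->
  forall z, unit_disk z -> (1 - Cmod z ^ 2) * Cmod (pre_schwarzian f z) <= M.
Proof.
  intros HM.
  assert (S1 : forall s, 0 < s < 1 -> (1 - s ^ 2) * Re (P (RtoC s)) <= M).
  { intros s Hs. eapply Rle_trans; [|exact (HM s Hs)]. rewrite bound_at_eq.
    destruct (P_Q_ge_0 s ltac:(lra)) as [_ HQ].
    replace ((1 - s ^ 2) / s * (s * Re (P (RtoC s)) + Re (Q (RtoC s))))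
      with ((1 - s ^ 2) * Re (P (RtoC s)) + (1 - s ^ 2) * (/ s * Re (Q (RtoC s)))) by (field; lra).
    assert (0 <= (1 - s ^ 2) * (/ s * Re (Q (RtoC s)))); [|lra].
    apply Rmult_le_pos. nra. apply Rmult_le_pos; auto. apply Rlt_le, Rinv_0_lt_compat; lra. }
  assert (Dq : forall z, is_cderive (fun z => 1 + - (1) * (z * z))%C z
    (0 + - (1) * (1 * z + z * 1))%C).
  { intros z. apply (is_cderive_plus (fun _ => RtoC 1)). apply is_cderive_const.
    apply (is_cderive_scal _ (fun z => z * z)%C).
    apply (is_cderive_mult (fun z => z) (fun z => z)); apply is_cderive_id. }
  assert (Eq : forall s : R, (1 + - (1) * (s * s))%C = RtoC (1 - s ^ 2)).
  { intros s. unfold RtoC, Cplus, Copp, Cmult; simpl; f_equal; ring. }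
  (* The case omega z = 0 is to be compared with P(0), a limit of (1 - s^2) P(s). *)
  assert (P0_le : Re (P (RtoC 0)) <= M).
  { assert (D : is_cderive (fun z => (1 + - (1) * (z * z)) * P z)%C (RtoC 0)
      ((0 + - (1) * (1 * 0 + 0 * 1)) * P 0%C + (1 + - (1) * (0 * 0)) * C_derive P 0%C)%C).
    { apply (is_cderive_mult (fun z => 1 + - (1) * (z * z))%C P). apply Dq.
      apply analytic_at_is_cderive, P_analytic, unit_disk_0. }
    replace (P (RtoC 0)) with ((1 + - (1) * (0 * 0)) * P 0%C)%C by ring.
    apply (Re_le_at_0 _ _ M D). intros s Hs. rewrite Eq, re_scal_l. auto. }
  assert (B : forall z, unit_disk z -> z <> 0 -> (1 - Cmod z ^ 2) * Cmod (pre_schwarzian f z) <= M).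
  { intros z Hz N. rewrite pre_schwarzian_eq by auto.
    fold (P (omega z)). fold (Q (omega z)).
    pose proof (schwarz_pick _ _ (analytic_C1 _ om_an) om_disk z Hz) as SP.
    pose proof (schwarz _ _ (analytic_C1 _ om_an) om_disk om_0 z Hz) as SL.
    pose proof (nonneg_maclaurin_majorant P P_analytic P_nonneg _ (om_disk z Hz)) as MP.
    pose proof (nonneg_maclaurin_majorant Q Q_analytic Q_nonneg _ (om_disk z Hz)) as MQ.
    set (s := Cmod (omega z)) in *. assert (Hs : 0 <= s) by apply Cmod_ge_0.
    assert (Hr : 0 < Cmod z < 1) by (split; [now apply Cmod_gt_0|exact Hz]). set (r := Cmod z) in *.
    destruct (P_Q_ge_0 s ltac:(lra)) as [p0 q0].
    set (p := Re (P (RtoC s))) in *. set (q := Re (Q (RtoC s))) in *.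
    set (dw := Cmod (C_derive omega z)) in *.
    assert (Hdw : 0 <= dw) by apply Cmod_ge_0.
    assert (H1r : 0 <= 1 - r ^ 2) by nra.
    apply Rle_trans with ((1 - s ^ 2) * p + (1 - r ^ 2) / r * q).
    { eapply Rle_trans. apply Rmult_le_compat_l; [exact H1r|]. apply Cmod_triangle.
      rewrite Rmult_plus_distr_l. apply Rplus_le_compat.
      - rewrite Cmod_mult. fold dw. apply Rle_trans with (dw * (1 - r ^ 2) * p).
        replace (dw * (1 - r ^ 2) * p) with ((1 - r ^ 2) * (p * dw)) by ring.
        apply Rmult_le_compat_l; auto. now apply Rmult_le_compat_r.
        now apply Rmult_le_compat_r.
      - rewrite Cmod_div by auto. fold r. unfold Rdiv. rewrite Rmult_assoc.
        apply Rmult_le_compat_l; auto.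
        rewrite Rmult_comm. apply Rmult_le_compat_l; auto. apply Rlt_le, Rinv_0_lt_compat; lra. }
    destruct (Rle_lt_dec s 0) as [S0|Sp].
    - assert (E : s = 0) by lra. unfold p, q. rewrite E. unfold Q at 1. rewrite phi_0.
      replace (1 - 1)%C with (RtoC 0) by ring. rewrite re_RtoC. lra.
    - eapply Rle_trans; [|apply (HM s ltac:(lra))]. rewrite bound_at_eq. fold p q.
      replace ((1 - s ^ 2) / s * (s * p + q)) with ((1 - s ^ 2) * p + (1 - s ^ 2) / s * q)
        by (field; lra).
      apply Rplus_le_compat_l. apply Rmult_le_compat_r; auto.
      replace ((1 - r ^ 2) / r) with (/ r - r) by (field; lra).
      replace ((1 - s ^ 2) / s) with (/ s - s) by (field; lra).
      pose proof (Rinv_le_contravar s r Sp SL). lra. }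
  intros z Hz. destruct (Ceq_dec z 0) as [->|N]; [|now apply B].
  set (F := pre_schwarzian f) in *.
  assert (FD : is_cderive F (RtoC 0) (C_derive F 0)).
  { destruct f_A as [f_an _]. apply analytic_at_is_cderive, analytic_at_div.
    apply analytic_at_C_derive, analytic_at_C_derive, f_an, unit_disk_0.
    apply analytic_at_C_derive, f_an, unit_disk_0.
    apply starlike_deriv_nz, unit_disk_0. }
  (* After rotation by e^*, the real part of (1 - s^2) F(s) is at most M and tends to |F(0)|. *)
  destruct (Cpolar (F 0)) as [e [He Ee]].
  pose proof (is_cderive_scal (Cconj e) _ _ _ (is_cderive_mult _ F _ _ _ (Dq (RtoC 0)) FD)) as D.
  apply (Re_le_at_0 _ _ M) in D.
  - cbv beta in D. replace (1 + - (1) * (0 * 0))%C with (RtoC 1) in D by ring.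
    change (Re (Cconj e * (1 * F (RtoC 0))) <= M) in D. rewrite Ee in D.
    replace (Cconj e * (1 * (RtoC (Cmod (F 0)) * e)))%C
      with (RtoC (Cmod (F 0)) * (e * Cconj e))%C in D by ring.
    rewrite <- Cmod2_conj, He, re_scal_l in D. simpl in D. rewrite Cmod_0. simpl. lra.
  - intros s Hs. rewrite Eq. eapply Rle_trans. apply Rle_abs. eapply Rle_trans. apply re_le_Cmod.
    rewrite !Cmod_mult, Cmod_conj, He, Rmult_1_l, Cmod_R, Rabs_pos_eq by nra.
    replace (s ^ 2) with (Cmod (RtoC s) ^ 2) by (rewrite Cmod_R, Rabs_pos_eq; lra).
    apply B. unfold unit_disk. rewrite Cmod_R, Rabs_pos_eq; lra. intros E. apply RtoC_inj in E. lra.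
Qed.
End Pre_schwarzian.

Theorem theorem2p3 (phi : C -> C)
  (hphi : class_M phi)
  (hP : nonneg_maclaurin (fun z : C => (C_derive phi z / phi z)%C))
  (hQ : nonneg_maclaurin (fun z : C => (phi z - RtoC 1)%C))
  (f : C -> C) (hf : ma_minda phi f) :
  Rbar_le (pre_schwarzian_norm f)
    (Lub_Rbar (fun x : R => exists s : R, 0 < s < 1 /\ x = bound_at phi s)).
Proof.
  destruct hphi as [phi_an [_ [phi_pos [phi_0 _]]]].
  destruct hf as [f_A [f_nz [omega [om_an [om_disk [om_0 sub]]]]]].
  apply (proj2 (Lub_Rbar_correct _)). intros x [z [Hz ->]].
  pose proof (proj1 (Lub_Rbar_correct (fun x : R => exists s : R, 0 < s < 1
    /\ x = bound_at phi s))) as HM.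
  destruct (Lub_Rbar _) as [M| |].
  - apply (pre_schwarzian_bound phi f omega phi_an phi_pos f_A f_nz om_an om_disk om_0 sub hP hQ
      phi_0); auto.
    intros s Hs. apply HM. now exists s.
  - exact I.
  - destruct (HM (bound_at phi (1 / 2))). exists (1 / 2). split; [lra|reflexivity].
Qed.
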